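(* Let $A$ be a commutative Noetherian ring containing a field $K$ of characteristic zero, let $m\ge 1$, let $G$ be a finite group and let $\Phi\colon G\to GL_m(A)$ be a group homomorphism. Let $R=A[X_1,\ldots,X_m]$ be graded with $\deg A=0$ and $\deg X_i=1$ for all $i$, let $G$ act linearly on $R$ via $\Phi$, fixing $A$, and let $S=R^G$. Let $I$ be a homogeneous ideal of $S$, let $i\ge 0$, and let $M=H^i_I(S)=\bigoplus_{n\in\mathbb{Z}}M_n$. If $M_n=0$ for all $|n|\gg 0$, then $M=0$.
   Context: $G$ acting linearly on $R$ fixing $A$ via $\Phi$ means that $G$ acts by graded $A$-algebra automorphisms whose action on the free $A$-module $R_1=\bigoplus_i AX_i$ is given by $\Phi$. The ring of invariants $S=R^G$ is a graded subring of $R$ (in general not standard graded) with $S_0=A$. $H^i_I(S)$ denotes local cohomology of $S$ with support in $I$, with its natural $\mathbb{Z}$-grading; $M_n$ is its degree $n$ component. *)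

(* Defs.v *)
From HB Require Import structures.
From mathcomp Require Import all_boot all_order all_algebra all_fingroup.
From mathcomp Require Import mpoly.

Set Implicit Arguments.
Unset Strict Implicit.
Unset Printing Implicit Defensive.

Import Order.TTheory GRing.Theory Num.Theory.
Local Open Scope ring_scope.

(* Ideals and graded pieces are Prop-valued predicates, so that no
   decidability of membership is assumed. *)

Definition is_ideal (R : comNzRingType) (J : R -> Prop) : Prop :=
  [/\ J 0,
      forall x y, J x -> J y -> J (x + y) &
      forall a x, J x -> J (a * x)].

Definition noetherian (R : comNzRingType) : Prop :=
  forall J : R -> Prop, is_ideal J ->
    exists (k : nat) (g : 'I_k -> R),
      (forall j, J (g j)) /\
      (forall x, J x -> exists c : 'I_k -> R, x = \sum_j c j * g j).

(* V is the internal direct sum of the subgroups C j, j : T. *)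
Definition direct_sum (T : eqType) (V : zmodType) (C : T -> V -> Prop) : Prop :=
  [/\ forall j, C j 0,
      forall j x y, C j x -> C j y -> C j (x - y),
      forall x, exists (r : seq T) (c : T -> V),
        [/\ uniq r, forall j, C j (c j) & x = \sum_(j <- r) c j] &
      forall (r : seq T) (c : T -> V), uniq r -> (forall j, C j (c j)) ->
        \sum_(j <- r) c j = 0 -> forall j, j \in r -> c j = 0].

Record gring := MkGRing {
  gr_car :> comNzRingType;
  gr_comp : nat -> gr_car -> Prop;
  gr_dec : direct_sum gr_comp;
  gr_one : gr_comp 0 1;
  gr_mul : forall d e x y,
    gr_comp d x -> gr_comp e y -> gr_comp (d + e) (x * y) }.

Definition homogeneous (S : gring) (I : S -> Prop) : Prop :=
  forall (r : seq nat) (c : nat -> S), uniq r -> (forall d, gr_comp d (c d)) ->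
    I (\sum_(d <- r) c d) -> forall d, d \in r -> I (c d).

Record gmod (S : gring) := GMod {
  gm_car :> lmodType S;
  gm_comp : int -> gm_car -> Prop;
  gm_dec : direct_sum gm_comp;
  gm_scale : forall (d : nat) (n : int) (s : S) (x : gm_car),
    gr_comp d s -> gm_comp n x -> gm_comp (d%:Z + n) (s *: x) }.

Section Regular.
Variable S : gring.

Definition reg_comp (n : int) (x : S^o) : Prop :=
  match n with Posz d => gr_comp d (x : S) | Negz _ => x = 0 end.

Lemma reg_dec : direct_sum reg_comp.
Proof.
case: (gr_dec S) => C0 CB Cex Cun; split.
- by case=> n; [exact: C0 | ].
- case=> n x y /=; first exact: CB.
  by move=> -> ->; rewrite subr0.
- move=> x; have [r [c [ur hc ->]]] := Cex x.
  exists (map Posz r), (fun n => if n is Posz d then c d else 0); split.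
  + by rewrite map_inj_uniq // => a b [].
  + by case=> n //=; exact: hc.
  + by rewrite big_map.
- move=> r c ur hc hs j jr.
  have cN n : c (Negz n) = 0 by exact: hc (Negz n).
  pose P (n : int) := if n is Posz _ then true else false.
  pose r' := map absz (filter P r).
  have PK : map Posz r' = filter P r.
    rewrite /r' -map_comp -[RHS]map_id; apply/eq_in_map => -[n|n] //=.
    by rewrite mem_filter.
  have ur' : uniq r'.
    by rewrite -(@map_inj_uniq _ _ Posz) ?PK ?filter_uniq // => a b [].
  have hs' : \sum_(d <- r') (c (Posz d) : S) = 0.
    rewrite -(big_map Posz xpredT (fun n => (c n : S))) PK big_filter big_mkcond.
    rewrite -[RHS]hs; apply: eq_bigr => -[n|n] _ //=.
  case: j jr => n jr; last exact: cN.
  apply: (Cun r' (fun d => c (Posz d)) ur' _ hs').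
    by move=> d; exact: (hc (Posz d)).
  by rewrite -(@mem_map _ _ Posz) ?PK ?mem_filter // => a b [].
Qed.

Lemma reg_scale (d : nat) (n : int) (s : S) (x : S^o) :
  gr_comp d s -> reg_comp n x -> reg_comp (d%:Z + n) (s *: x).
Proof.
case: n => [n|n] hs /=; first exact: gr_mul.
move=> ->; rewrite scaler0; case: (_ + _) => k //=.
by case: (gr_dec S).
Qed.

Definition reg_gmod : gmod S := GMod reg_dec reg_scale.

End Regular.

(* Local cohomology as the right derived functors of the I-torsion functor on
   the category of graded S-modules and degree-0 maps; for S Noetherian and I
   homogeneous, forgetting the grading gives the ungraded H^i_I. *)

Section LocalCohomology.
Variable S : gring.
Implicit Types M N E : gmod S.

Definition degree0 M N (f : {linear M -> N}) : Prop :=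
  forall (n : int) (x : M), gm_comp n x -> gm_comp n (f x).

Definition graded_injective E : Prop :=
  forall M N (j : {linear M -> N}) (f : {linear M -> E}),
    degree0 j -> degree0 f -> injective j ->
    exists h : {linear N -> E}, degree0 h /\ (forall x, h (j x) = f x).

(* 0 -> N -> E^0 -> E^1 -> ..., exact, with all E^q graded-injective. *)
Record injres N := InjRes {
  ir_obj :> nat -> gmod S;
  ir_aug : {linear N -> ir_obj 0};
  ir_d : forall q, {linear ir_obj q -> ir_obj q.+1};
  ir_aug_deg : degree0 ir_aug;
  ir_d_deg : forall q, degree0 (ir_d q);
  ir_inj : forall q, graded_injective (ir_obj q);
  ir_aug_inj : injective ir_aug;
  ir_exact0 : forall x, ir_d 0 x = 0 <-> exists y, ir_aug y = x;
  ir_exactS : forall q x, ir_d q.+1 x = 0 <-> exists y, ir_d q y = x }.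

Variable I : S -> Prop.

(* x is killed by some power I^k; the ideal I^k is generated by the products
   of k elements of I. *)
Definition torsion M (x : M) : Prop :=
  exists k : nat, forall a : 'I_k -> S, (forall j, I (a j)) ->
    (\prod_j a j) *: x = 0.

Definition cocycle N (E : injres N) (i : nat) (x : E i) : Prop :=
  torsion x /\ ir_d E i x = 0.

Definition coboundary N (E : injres N) (i : nat) : E i -> Prop :=
  match i with
  | 0 => fun x => x = 0
  | q.+1 => fun x => exists y : E q, torsion y /\ ir_d E q y = x
  end.

(* M is the graded S-module H^i_I(N): it is the quotient of the degree-i
   cocycles of Gamma_I(E) by the coboundaries, for some graded-injective
   resolution E of N. The map pi is the quotient map; only its values on
   cocycles are constrained. Since pi is onto and preserves degrees, the
   grading of M is the one induced from E. *)
Definition is_local_cohomology (i : nat) N M : Prop :=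
  exists (E : injres N) (pi : E i -> M),
    [/\ forall (s : S) (x y : E i), cocycle x -> cocycle y ->
          pi (s *: x + y) = s *: pi x + pi y,
        forall (n : int) (x : E i), cocycle x -> gm_comp n x ->
          gm_comp n (pi x),
        forall z : M, exists2 x : E i, cocycle x & pi x = z &
        forall x : E i, cocycle x -> (pi x = 0 <-> coboundary x)].

End LocalCohomology.

Section Invariants.
Variables (A : comNzRingType) (m : nat).

(* The A-algebra endomorphism X_j |-> \sum_i P_ij X_i of A[X_1..X_m]; on the
   free module with basis the X_i it has matrix P (acting on columns of
   coordinates). *)
Definition lin_act (P : 'M[A]_m) (p : {mpoly A[m]}) : {mpoly A[m]} :=
  p \mPo [tuple \sum_i P i j *: 'X_i | j < m].

Variable gT : finGroupType.

Definition is_GL_hom (Phi : gT -> 'M[A]_m) : Prop :=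
  (forall g, exists Q, Phi g *m Q = 1%:M /\ Q *m Phi g = 1%:M) /\
  (forall g h, Phi (g * h)%g = Phi g *m Phi h).

Variable Phi : gT -> 'M[A]_m.

Definition invariant : pred {mpoly A[m]} :=
  fun p => [forall g, lin_act (Phi g) p == p].

Lemma invariantP p :
  reflect (forall g, lin_act (Phi g) p = p) (p \in invariant).
Proof. by apply: (iffP forallP) => h g; apply/eqP; exact: h. Qed.

Lemma invariant_subring : subring_closed invariant.
Proof.
split.
- by apply/invariantP => g; rewrite /lin_act rmorph1.
- move=> p q /invariantP hp /invariantP hq; apply/invariantP => g.
  by rewrite /lin_act rmorphB; congr (_ - _); [exact: hp | exact: hq].
- move=> p q /invariantP hp /invariantP hq; apply/invariantP => g.
  by rewrite /lin_act rmorphM; congr (_ * _); [exact: hp | exact: hq].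
Qed.

HB.instance Definition _ :=
  GRing.isSubringClosed.Build {mpoly A[m]} invariant invariant_subring.

Record inv_ring := InvRing {
  inv_val :> {mpoly A[m]};
  _ : inv_val \in invariant }.

HB.instance Definition _ := [isSub for inv_val].
HB.instance Definition _ := [Choice of inv_ring by <:].
HB.instance Definition _ := [SubChoice_isSubComNzRing of inv_ring by <:].

Lemma lin_act_homog (P : 'M[A]_m) d p :
  p \is d.-homog -> lin_act P p \is d.-homog.
Proof.
move=> /dhomogP hp; rewrite /lin_act comp_mpolyEX.
rewrite big_seq; apply: rpred_sum => u hu; apply: dhomogZ.
have <- : mdeg u = d by exact: hp.
rewrite comp_mpolyX mdegE; elim/big_ind2: _ => //.
- exact: dhomog1.
- by move=> a b c e; exact: dhomogM.
move=> i _; rewrite -[X in X.-homog]mul1n; apply: dhomogMn.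
rewrite tnth_mktuple; apply: rpred_sum => k _; apply: dhomogZ.
by rewrite dhomogX; apply/eqP; exact: mdeg1.
Qed.

Lemma pihomog_lin_act (P : 'M[A]_m) d p :
  pihomog mdeg d (lin_act P p) = lin_act P (pihomog mdeg d p).
Proof.
have h : (mmeasure mdeg p <= maxn (mmeasure mdeg p) d.+1)%N by exact: leq_maxl.
have hd : (d < maxn (mmeasure mdeg p) d.+1)%N by exact: leq_maxr.
have hL e : lin_act P (pihomog mdeg e p) \is e.-homog.
  by apply: lin_act_homog; exact: pihomogP.
rewrite [in LHS](@pihomog_partitionE _ _ mdeg _ p h) /lin_act.
rewrite (raddf_sum (comp_mpoly _)) raddf_sum (bigD1 (Ordinal hd)) //=.
rewrite big1 ?addr0 => [|e ne]; first exact: pihomog_dE (hL d).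
exact: pihomog_ne0 ne (hL e).
Qed.

Definition inv_comp (d : nat) (x : inv_ring) : Prop := inv_val x \is d.-homog.

Lemma inv_dec : direct_sum inv_comp.
Proof.
split.
- by move=> d; exact: dhomog0.
- by move=> d x y hx hy; rewrite /inv_comp /= rpredB.
- move=> x.
  have inv d : pihomog mdeg d (inv_val x) \in invariant.
    apply/invariantP => g; rewrite -pihomog_lin_act.
    by have /invariantP -> := valP x.
  exists (iota 0 (mmeasure mdeg (inv_val x))), (fun d => InvRing (inv d)).
  split; [exact: iota_uniq | by move=> d; exact: pihomogP |].
  apply: val_inj; rewrite (raddf_sum val) /=.
  rewrite [LHS](@pihomog_partitionE _ _ mdeg _ (inv_val x) (leqnn _)).
  by rewrite -(big_mkord xpredT (fun d => pihomog mdeg d (inv_val x)))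
     /index_iota subn0.
- move=> r c ur hc hs j jr; apply: val_inj => /=.
  have : pihomog mdeg j (val (\sum_(d <- r) c d)) = 0 by rewrite hs raddf0.
  rewrite (raddf_sum val) raddf_sum (bigD1_seq j) //=.
  rewrite big1 ?addr0 => [|e ne]; last exact: pihomog_ne0 ne (hc e).
  by rewrite (pihomog_dE (hc j)).
Qed.

Lemma inv_one : inv_comp 0 1.
Proof. exact: dhomog1. Qed.

Lemma inv_mul d e x y :
  inv_comp d x -> inv_comp e y -> inv_comp (d + e) (x * y).
Proof. exact: dhomogM. Qed.

Definition inv_gring : gring := MkGRing inv_dec inv_one inv_mul.

End Invariants.

(* Main.v *)
From HB Require Import structures.
From mathcomp Require Import all_boot all_order all_algebra all_fingroup.
From mathcomp Require Import mpoly.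
From mathcomp Require Import generic_quotient boolp ring zify.
Require Import Defs.

Set Implicit Arguments.
Unset Strict Implicit.
Unset Printing Implicit Defensive.

Import Order.TTheory GRing.Theory Num.Theory.
Local Open Scope quotient_scope.
Local Open Scope ring_scope.

(* Local cohomology of S is computed by the Cech complex of homogeneous
   generators of I: a graded-injective module E is f-divisible up to f-torsion
   in a way that does not enlarge annihilators, so the Cech complex of E reduces
   to the torsion submodule. The Cech complex of S is the G-invariant part of the
   Cech complex of R, on which R, G and the partial derivatives act.
   A class u of H^i_I(S) lives in bounded degrees, and X_1 is integral over the
   elementary symmetric functions of its G-orbit, which lie in S; hence a power
   of X_1 kills u in H^i_I(R). The same argument applied to the G-orbit of
   d/dX_1, whose elementary symmetric functions preserve invariants and lower
   the degree, shows that a power of d/dX_1 kills u. In characteristic 0 the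
   relation [d/dX_1, X_1] = 1 then forces u = 0 in H^i_I(R), and the Reynolds
   operator brings this back to H^i_I(S). *)

(** * Localization at an endomorphism *)

(** The bound on degrees is given for S only, whereas X_1 and d/dX_1 act on R and do not preserve S,
    and nothing is known beforehand about the degrees of H^i_I(R). The vanishing can therefore be
    invoked only for invariant classes, which is why nilpotency goes through symmetric functions of
    whole orbits. Derivations extend to localizations by the quotient rule but have no evident
    action on an injective resolution; this forces the passage to Cech complexes. The comparison is
    made by vanishing alone, one bidegree at a time, so that no Cech cohomology group is ever
    formed. The Cech complex is an iterated cone over a bare abelian group with commuting operators:
    quasi-isomorphisms, torsion and Weyl operators are treated for one cone, and induction on the
    list of generators does the rest. The complex of S is not built separately; it is the complex of
    R with a smaller bigrading. *)

Section Localization.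

Variables (V : zmodType) (f : {additive V -> V}).

Lemma iter_is_additive n : zmod_morphism (iter n f).
Proof. by elim: n => [|n IH] x y //=; rewrite IH raddfB. Qed.

HB.instance Definition _ n :=
  GRing.isZmodMorphism.Build V V (iter n f) (iter_is_additive n).

(** The pair [(k, v)] stands for f^-k v. The [n] additional iterations make the relation transitive
    although [f] need not be injective. *)
Definition frac_eq (x y : nat * V) : bool :=
  `[< exists n, iter (n + y.1) f x.2 = iter (n + x.1) f y.2 >].

Lemma frac_eq_refl : reflexive frac_eq.
Proof. by move=> x; apply/asboolP; exists 0%N. Qed.

Lemma frac_eq_sym : ssrbool.symmetric frac_eq.
Proof.
by move=> x y; apply/asboolP/asboolP => -[n e]; exists n; rewrite e.
Qed.

Lemma frac_eq_trans : transitive frac_eq.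
Proof.
move=> y x z /asboolP[n e] /asboolP[k e']; apply/asboolP.
exists (n + k + y.1)%N.
rewrite (_ : n + k + y.1 + z.1 = (k + z.1) + (n + y.1))%N; last by lia.
rewrite iterD e -iterD.
rewrite (_ : k + z.1 + (n + x.1) = (n + x.1) + (k + z.1))%N; last by lia.
by rewrite iterD e' -iterD; congr (iter _ f _); lia.
Qed.

Canonical frac_eq_equiv :=
  EquivRel frac_eq frac_eq_refl frac_eq_sym frac_eq_trans.

Definition loc := {eq_quot frac_eq}.
HB.instance Definition _ := Choice.on loc.
HB.instance Definition _ := EqQuotient.on loc.

Definition frac (k : nat) (v : V) : loc := \pi_loc (k, v).

Lemma fracP (x : loc) : exists k v, x = frac k v.
Proof. by exists (repr x).1, (repr x).2; rewrite /frac -surjective_pairing reprK. Qed.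

Lemma eq_frac k v l w :
  frac k v = frac l w <-> exists n, iter (n + l) f v = iter (n + k) f w.
Proof.
split=> [/eqP|h]; first by rewrite eqmodE => /asboolP.
by apply/eqP; rewrite eqmodE; apply/asboolP.
Qed.

Lemma fracM n k v : frac (n + k) (iter n f v) = frac k v.
Proof. by apply/eq_frac; exists 0%N; rewrite !add0n -iterD addnC. Qed.

Lemma fracS k v : frac k.+1 (f v) = frac k v.
Proof. exact: (fracM 1). Qed.

Lemma fracMr n k v : frac (k + n) (iter n f v) = frac k v.
Proof. by rewrite addnC fracM. Qed.

Definition loc_zero : loc := frac 0 0.
Definition loc_opp (x : loc) : loc := frac (repr x).1 (- (repr x).2).
Definition loc_add (x y : loc) : loc :=
  frac ((repr x).1 + (repr y).1)
    (iter (repr y).1 f (repr x).2 + iter (repr x).1 f (repr y).2).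

Lemma loc_oppE k v : loc_opp (frac k v) = frac k (- v).
Proof.
rewrite /loc_opp; set x := repr _.
have : frac x.1 x.2 = frac k v by rewrite /frac -surjective_pairing reprK.
by move/eq_frac=> [n e]; apply/eq_frac; exists n; rewrite !raddfN /= e.
Qed.

Lemma loc_addE k v l w :
  loc_add (frac k v) (frac l w) = frac (k + l) (iter l f v + iter k f w).
Proof.
rewrite /loc_add; set x := repr _; set y := repr _.
have : frac x.1 x.2 = frac k v by rewrite /frac -surjective_pairing reprK.
have : frac y.1 y.2 = frac l w by rewrite /frac -surjective_pairing reprK.
move=> /eq_frac[n e] /eq_frac[n' e']; apply/eq_frac; exists (n + n')%N.
rewrite !raddfD /= -!iterD; congr (_ + _).
  rewrite (_ : n + n' + (k + l) + y.1 = (n + l + y.1) + (n' + k))%N; last by lia.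
  by rewrite iterD e' -iterD; congr (iter _ f _); lia.
rewrite (_ : n + n' + (k + l) + x.1 = (n' + k + x.1) + (n + l))%N; last by lia.
by rewrite iterD e -iterD; congr (iter _ f _); lia.
Qed.

Lemma loc_addC : commutative loc_add.
Proof.
move=> x y; have [k [v ->]] := fracP x; have [l [w ->]] := fracP y.
by rewrite !loc_addE addrC addnC.
Qed.

Lemma loc_addA : associative loc_add.
Proof.
move=> x y z; have [k [v ->]] := fracP x; have [l [w ->]] := fracP y.
have [r [u ->]] := fracP z.
rewrite !loc_addE !raddfD /= -!iterD addrA addnA.
by congr (frac _ (_ + _ + _)); congr (iter _ f _); lia.
Qed.

Lemma loc_add0 : left_id loc_zero loc_add.
Proof.
by move=> x; have [k [v ->]] := fracP x; rewrite loc_addE /= raddf0 add0r.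
Qed.

Lemma loc_addN : left_inverse loc_zero loc_opp loc_add.
Proof.
move=> x; have [k [v ->]] := fracP x; rewrite loc_oppE loc_addE raddfN addNr.
by apply/eq_frac; exists 0%N; rewrite !raddf0.
Qed.

HB.instance Definition _ :=
  GRing.isZmodule.Build loc loc_addA loc_addC loc_add0 loc_addN.

Lemma frac_is_additive k : zmod_morphism (frac k).
Proof.
move=> v w; rewrite -[_ - _ in RHS]/(loc_add _ (loc_opp _)) loc_oppE loc_addE.
by rewrite -raddfD /= fracM.
Qed.

HB.instance Definition _ k :=
  GRing.isZmodMorphism.Build V loc (frac k) (frac_is_additive k).

Lemma frac_eq0 k v : frac k v = 0 <-> exists n, iter n f v = 0.
Proof.
rewrite -(raddf0 (frac 0)); split=> [/eq_frac[n]|[n e]].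
  by rewrite addn0 raddf0 => e; exists n.
by apply/eq_frac; exists n; rewrite addn0 e raddf0.
Qed.

Lemma frac_common x y : exists k v w, x = frac k v /\ y = frac k w.
Proof.
have [k [v ->]] := fracP x; have [l [w ->]] := fracP y.
by exists (k + l)%N, (iter l f v), (iter k f w); rewrite fracMr fracM.
Qed.

Section Lift.

Variables (U : zmodType) (phi : nat -> {additive V -> U}).
Hypothesis phiS : forall k v, phi k.+1 (f v) = phi k v.

Lemma lift_phiM n k v : phi (n + k)%N (iter n f v) = phi k v.
Proof. by elim: n => [|n IH] //=; rewrite addSn phiS. Qed.

(** A map is prescribed on each denominator f^k separately, instead of extending one map that
    inverts [f]. This generality is what the quotient rule needs, since its value on v/f^k involves
    k. *)
Lemma lift_subproof : {g : loc -> U | forall k v, g (frac k v) = phi k v}.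
Proof.
exists (fun x => phi (repr x).1 (repr x).2) => k v; set x := repr _.
have : frac x.1 x.2 = frac k v by rewrite /frac -surjective_pairing reprK.
move/eq_frac=> [n e].
by rewrite -(lift_phiM (n + k)) e -(lift_phiM (n + x.1) k); congr (phi _ _); lia.
Qed.

Definition lift : loc -> U := sval lift_subproof.

Lemma liftE k v : lift (frac k v) = phi k v.
Proof. exact: (svalP lift_subproof). Qed.

Lemma lift_is_additive : zmod_morphism lift.
Proof.
move=> x y; have [k [v [w [-> ->]]]] := frac_common x y.
by rewrite -raddfB !liftE raddfB.
Qed.

HB.instance Definition _ :=
  GRing.isZmodMorphism.Build loc U lift lift_is_additive.

End Lift.

End Localization.

Arguments frac {V f}.

(** * Complexes, cones and Cech complexes *)

Section LocMap.

Variables (V V' : zmodType) (f : {additive V -> V}) (f' : {additive V' -> V'}).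
Variable phi : {additive V -> V'}.
Hypothesis phif : forall v, phi (f v) = f' (phi v).

Lemma loc_map_compat k v :
  (frac k.+1 \o phi : {additive V -> loc f'}) (f v) = (frac k \o phi) v.
Proof. by rewrite /= phif fracS. Qed.

Definition loc_map : {additive loc f -> loc f'} :=
  lift loc_map_compat.

Lemma loc_mapE k v : loc_map (frac k v) = frac k (phi v).
Proof. exact: liftE. Qed.

Lemma morph_iter n v : phi (iter n f v) = iter n f' (phi v).
Proof. by elim: n => [|n IH] //=; rewrite phif IH. Qed.

End LocMap.

Section Complexes.

Variables (L : Type) (e : L -> nat).

Record complex := Complex {
  cx_car :> zmodType;
  cx_d : {additive cx_car -> cx_car};
  cx_f : L -> {additive cx_car -> cx_car};
  cx_dd : forall v, cx_d (cx_d v) = 0;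
  cx_df : forall l v, cx_d (cx_f l v) = cx_f l (cx_d v);
  cx_ff : forall l l' v, cx_f l (cx_f l' v) = cx_f l' (cx_f l v) }.

(* The first integer is the cohomological degree, the second one the internal
   degree. A bigrading need not exhaust the complex: passing to a subcomplex
   just means shrinking P. *)
Definition bigrading (C : zmodType) := int -> int -> C -> Prop.

Record bigraded (C : complex) (P : bigrading C) : Prop := Bigraded {
  bg0 : forall q n, P q n 0;
  bgB : forall q n v w, P q n v -> P q n w -> P q n (v - w);
  bg_d : forall q n v, P q n v -> P (q + 1) n (cx_d C v);
  bg_f : forall q n l v, P q n v -> P q (n + (e l)%:Z) (cx_f C l v) }.

Lemma bgN C (P : bigrading (cx_car C)) (gP : bigraded P) q n v :
  P q n v -> P q n (- v).
Proof. by rewrite -sub0r; apply: (bgB gP); exact: (bg0 gP). Qed.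

Lemma bgD C (P : bigrading (cx_car C)) (gP : bigraded P) q n v w :
  P q n v -> P q n w -> P q n (v + w).
Proof. by move=> hv hw; rewrite -[w]opprK; apply: (bgB gP) => //; exact: bgN. Qed.

Lemma bgMn C (P : bigrading (cx_car C)) (gP : bigraded P) q n v k :
  P q n v -> P q n (v *+ k).
Proof.
move=> hv; elim: k => [|k IH]; first exact: (bg0 gP).
by rewrite mulrS; exact: bgD.
Qed.

Lemma bg_iter C (P : bigrading (cx_car C)) (gP : bigraded P) q n l k v :
  P q n v -> P q (n + (e l * k)%:Z) (iter k (cx_f C l) v).
Proof.
move=> hv; elim: k => [|k IH]; first by rewrite muln0 addr0.
rewrite (_ : n + _ = n + (e l * k)%:Z + (e l)%:Z); first exact: (bg_f gP).
by rewrite mulnS; lia.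
Qed.

Definition loc_grading (l : L) (C : complex) (P : bigrading C) :
    bigrading (loc (cx_f C l)) :=
  fun q n w => exists k v, w = frac k v /\ P q (n + (e l * k)%:Z) v.

Lemma loc_gradingB l C (P : bigrading (cx_car C)) (gP : bigraded P) q n v w :
  loc_grading P q n v -> loc_grading P q n w ->
  loc_grading (l := l) P q n (v - w).
Proof.
move=> [k [v' [-> hv]]] [k' [w' [-> hw]]].
exists (k + k')%N, (iter k' (cx_f C l) v' - iter k (cx_f C l) w').
rewrite raddfB /= fracMr fracM; split=> //; apply: (bgB gP).
  rewrite (_ : n + _ = n + (e l * k)%:Z + (e l * k')%:Z);
    first exact: bg_iter.
  by rewrite mulnDr; lia.
rewrite (_ : n + _ = n + (e l * k')%:Z + (e l * k)%:Z);
    first exact: bg_iter.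
by rewrite mulnDr; lia.
Qed.

Lemma loc_grading_frac l C (P : bigrading (cx_car C)) q n k v :
  P q (n + (e l * k)%:Z) v -> loc_grading (l := l) P q n (frac k v).
Proof. by move=> h; exists k, v. Qed.

Lemma loc_grading_frac0 l C (P : bigrading (cx_car C)) q n v :
  P q n v -> loc_grading (l := l) P q n (frac 0 v).
Proof. by move=> h; apply: loc_grading_frac; rewrite muln0 addr0. Qed.

(** * The cone of a localization map *)

Section Cone.

Variables (l : L) (C : complex).

Definition loc_d : {additive loc (cx_f C l) -> loc (cx_f C l)} :=
  loc_map (@cx_df C l).

Definition cone_d (x : C * loc (cx_f C l)) : C * loc (cx_f C l) :=
  (cx_d C x.1, frac 0 x.1 - loc_d x.2).

Lemma cone_d_is_additive : zmod_morphism cone_d.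
Proof.
move=> x y; congr pair; rewrite /= !raddfB //=.
by rewrite addrACA.
Qed.

HB.instance Definition _ :=
  GRing.isZmodMorphism.Build _ _ cone_d cone_d_is_additive.

Definition loc_f l' : {additive loc (cx_f C l) -> loc (cx_f C l)} :=
  loc_map (@cx_ff C l' l).

Definition cone_f l' (x : C * loc (cx_f C l)) : C * loc (cx_f C l) :=
  (cx_f C l' x.1, loc_f l' x.2).

Lemma cone_f_is_additive l' : zmod_morphism (cone_f l').
Proof. by move=> x y; congr pair; rewrite /= raddfB. Qed.

HB.instance Definition _ l' :=
  GRing.isZmodMorphism.Build _ _ (cone_f l') (cone_f_is_additive l').

Lemma loc_dd w : loc_d (loc_d w) = 0.
Proof.
by have [k [v ->]] := fracP w; rewrite !loc_mapE cx_dd raddf0.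
Qed.

Lemma cone_dd x : cone_d (cone_d x) = 0.
Proof.
rewrite /cone_d /= cx_dd raddfB /= loc_dd subr0 loc_mapE.
by rewrite subrr.
Qed.

Lemma cone_df l' x : cone_d (cone_f l' x) = cone_f l' (cone_d x).
Proof.
rewrite /cone_d /cone_f /= cx_df; congr pair.
rewrite raddfB /= loc_mapE; congr (_ - _).
by have [k [v ->]] := fracP x.2; rewrite !loc_mapE cx_df.
Qed.

Lemma cone_ff l' l'' x : cone_f l' (cone_f l'' x) = cone_f l'' (cone_f l' x).
Proof.
rewrite /cone_f /= cx_ff; congr pair.
by have [k [v ->]] := fracP x.2; rewrite !loc_mapE cx_ff.
Qed.

(* The shifted cone of C -> C_f: the Cech complex with respect to f. *)
Definition cone : complex := Complex cone_dd cone_df cone_ff.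

Definition cone_grading (P : bigrading C) : bigrading cone :=
  fun q n x => P q n x.1 /\ loc_grading P (q - 1) n x.2.

Lemma cone_bigraded P : bigraded P -> bigraded (cone_grading P).
Proof.
move=> gP; split.
- move=> q n; split; first exact: (bg0 gP).
  by exists 0%N, 0; rewrite raddf0; split=> //; exact: (bg0 gP).
- move=> q n x y [hx hx'] [hy hy']; split; first exact: (bgB gP).
  exact: loc_gradingB.
- move=> q n x [hx [k [v [ex hv]]]]; split; first exact: (bg_d gP).
  rewrite addrK /= ex loc_mapE; apply: loc_gradingB => //.
    exact: loc_grading_frac0.
  by apply: loc_grading_frac; rewrite -(subrK 1 q); exact: (bg_d gP).
- move=> q n l' x [hx [k [v [ex hv]]]]; split; first exact: (bg_f gP).
  rewrite /= ex loc_mapE; apply: loc_grading_frac.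
  rewrite addrAC; exact: (bg_f gP).
Qed.

End Cone.

Arguments loc_d {l C}.
Arguments loc_f {l C}.

Definition acyclic (C : complex) (P : bigrading C) q n : Prop :=
  forall v, P q n v -> cx_d C v = 0 ->
    exists2 w, P (q - 1) n w & v = cx_d C w.

(** The last two clauses are injectivity and surjectivity on cohomology in each bidegree.
    Commutation with d is asked on graded elements only: the inclusion v |-> (v, 0) into a cone
    respects d exactly when v/1 = 0, hence on torsion elements but not everywhere. *)
Record qis (C C' : complex) (P : bigrading C) (P' : bigrading C')
    (phi : {additive C -> C'}) : Prop := Qis {
  qis_f : forall l v, phi (cx_f C l v) = cx_f C' l (phi v);
  qis_P : forall q n v, P q n v -> P' q n (phi v);
  qis_d : forall q n v, P q n v -> phi (cx_d C v) = cx_d C' (phi v);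
  qis_inj : forall q n v w', P q n v -> cx_d C v = 0 ->
    P' (q - 1) n w' -> phi v = cx_d C' w' ->
    exists2 w, P (q - 1) n w & v = cx_d C w;
  qis_surj : forall q n v', P' q n v' -> cx_d C' v' = 0 ->
    exists v w', [/\ P q n v, cx_d C v = 0, P' (q - 1) n w' &
                     v' = phi v + cx_d C' w'] }.

Lemma qis_acyclic C C' (P : bigrading (cx_car C)) (P' : bigrading (cx_car C'))
    phi q n : bigraded P -> bigraded P' ->
  qis P P' phi -> acyclic P q n <-> acyclic P' q n.
Proof.
move=> gP gP' [phif phiP phid phi_inj phi_surj]; split=> acy v hv dv.
  have [u [w [hu du hw ->]]] := phi_surj _ _ _ hv dv.
  have [w' hw' ->] := acy u hu du.
  exists (phi w' + w); first by apply: (bgD gP') => //; exact: phiP.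
  by rewrite raddfD (phid _ _ _ hw').
have dphi : cx_d C' (phi v) = 0 by rewrite -(phid _ _ _ hv) dv raddf0.
have [w hw e'] := acy _ (phiP _ _ _ hv) dphi.
exact: phi_inj hv dv hw e'.
Qed.

(** * Cones preserve quasi-isomorphisms *)

Section ConeQis.

Variables (l : L) (C C' : complex) (P : bigrading C) (P' : bigrading C').
Hypotheses (gP : bigraded P) (gP' : bigraded P').
Variable phi : {additive C -> C'}.
Hypothesis qphi : qis P P' phi.

Let phil : {additive loc (cx_f C l) -> loc (cx_f C' l)} :=
  loc_map (qis_f qphi l).

Lemma loc_qis_inj q n w w' : loc_grading P q n w -> loc_d w = 0 ->
  loc_grading P' (q - 1) n w' -> phil w = loc_d w' ->
  exists2 u, loc_grading P (q - 1) n u & w = loc_d u.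
Proof.
move=> [k [v [-> hv]]]; rewrite loc_mapE => /frac_eq0[a ea].
move=> [k' [v' [-> hv']]]; rewrite !loc_mapE => /eq_frac[b eb].
(* Denominators are cleared so that both numerators land in the degrees required: [a] iterations
   kill d v, [b] turn the equality of fractions into one in [C'], and [k], [k'] bring both sides to
   the common denominator. *)
have := @qis_inj _ _ _ _ _ qphi q (n + (e l * (a + b + k + k'))%:Z)
  (iter (a + b + k') (cx_f C l) v) (iter (a + b + k) (cx_f C' l) v').
case.
- rewrite (_ : n + _ = n + (e l * k)%:Z + (e l * (a + b + k'))%:Z);
    first exact: bg_iter.
  by rewrite !mulnDr; lia.
- rewrite (morph_iter (@cx_df C l)) (_ : a + b + k' = b + k' + a)%N; last by lia.
  by rewrite iterD ea raddf0.
- rewrite (_ : n + _ = n + (e l * k')%:Z + (e l * (a + b + k))%:Z);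
    first exact: bg_iter.
  by rewrite !mulnDr; lia.
- rewrite (morph_iter (@cx_df C' l)) (morph_iter (qis_f qphi l)).
  by rewrite -!addnA !(iterD a) eb.
move=> u hu eu; exists (frac (a + b + k + k') u); first exact: loc_grading_frac.
rewrite loc_mapE -eu (_ : a + b + k + k' = a + b + k' + k)%N; last by lia.
by rewrite fracM.
Qed.

Lemma loc_qis_surj q n w' : loc_grading P' q n w' -> loc_d w' = 0 ->
  exists w u, [/\ loc_grading P q n w, loc_d w = 0, loc_grading P' (q - 1) n u &
                  w' = phil w + loc_d u].
Proof.
move=> [k [v [-> hv]]]; rewrite loc_mapE => /frac_eq0[a ea].
have := @qis_surj _ _ _ _ _ qphi q (n + (e l * (a + k))%:Z) (iter a (cx_f C' l) v).
case.
- rewrite (_ : n + _ = n + (e l * k)%:Z + (e l * a)%:Z);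
    first exact: bg_iter.
  by rewrite !mulnDr; lia.
- by rewrite (morph_iter (@cx_df C' l)).
move=> x [y [hx dx hy exy]]; exists (frac (a + k) x), (frac (a + k) y).
split; try exact: loc_grading_frac.
  by rewrite loc_mapE dx raddf0.
by rewrite !loc_mapE -raddfD -exy /= fracM.
Qed.

Lemma loc_qis_d q n w : loc_grading P q n w -> phil (loc_d w) = loc_d (phil w).
Proof.
by move=> [k [v [-> hv]]]; rewrite !loc_mapE (qis_d qphi hv).
Qed.

Lemma loc_qis_P q n w : loc_grading P q n w -> loc_grading P' q n (phil w).
Proof.
move=> [k [v [-> hv]]]; rewrite loc_mapE; apply: loc_grading_frac.
exact: (qis_P qphi).
Qed.

Definition cone_map (x : cone l C) : cone l C' := (phi x.1, phil x.2).

Lemma cone_map_is_additive : zmod_morphism cone_map.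
Proof. by move=> x y; congr pair; rewrite /= raddfB. Qed.

HB.instance Definition _ :=
  GRing.isZmodMorphism.Build _ _ cone_map cone_map_is_additive.

Lemma loc_gradingD q n v w :
  loc_grading P q n v -> loc_grading P q n w ->
  loc_grading (l := l) P q n (v + w).
Proof.
move=> hv hw; rewrite -[w]opprK; apply: loc_gradingB => //; rewrite -sub0r.
apply: loc_gradingB => //; rewrite -(raddf0 (frac 0)).
by apply: loc_grading_frac0; exact: (bg0 gP).
Qed.

Lemma cone_dE (D : complex) (x : cone l D) a b :
  cx_d (cone l D) x = (a, b) <-> cx_d D x.1 = a /\ frac 0 x.1 - loc_d x.2 = b.
Proof. by split=> [[-> ->]|[<- <-]]. Qed.

(** This is the five lemma for the long exact sequences of the two cones, localization being exact;
    the chase is done on elements because the grading conditions have to be followed. *)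
Lemma cone_qis : qis (cone_grading (l := l) P) (cone_grading P') cone_map.
Proof.
have phil0 v : phil (frac 0 v) = frac 0 (phi v) by rewrite loc_mapE.
split.
- move=> l' [v w]; congr pair; first exact: (qis_f qphi).
  by rewrite /=; have [k [u ->]] := fracP w; rewrite !loc_mapE (qis_f qphi).
- move=> q n [v w] [hv hw]; split; first exact: (qis_P qphi).
  exact: loc_qis_P.
- move=> q n [v w] [hv hw]; congr pair; first exact: (qis_d qphi hv).
  by rewrite /= raddfB /= phil0 (loc_qis_d hw).
- move=> q n [v w] [a b] [/= hv hw] /cone_dE[/= dv dw] [/= ha hb].
  case=> ea eb.
  have [c hc ec] := qis_inj qphi hv dv ha ea.
  have dac : cx_d C' (a - phi c) = 0.
    by rewrite raddfB -(qis_d qphi hc) -ec ea subrr.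
  (* [c] bounds [v], but its image need not be [a]. The difference is a cocycle whose class lifts to
     [y]; removing both c/1 and y/1 from [w] leaves a cocycle whose image is a boundary. *)
  have [y [z [hy dy hz eyz]]] := qis_surj qphi
    (bgB gP' ha (qis_P qphi hc)) dac.
  pose w1 := w - frac 0 c - frac 0 y.
  have hw1 : loc_grading P (q - 1) n w1.
    apply: loc_gradingB => //; last exact: loc_grading_frac0.
    by apply: loc_gradingB => //; exact: loc_grading_frac0.
  have dw1 : loc_d w1 = 0.
    rewrite /w1 !raddfB /= !loc_mapE dy (raddf0 (frac 0)) subr0 -ec.
    by apply/eqP; rewrite subr_eq0 eq_sym -subr_eq0 dw.
  have ew1 : phil w1 = loc_d (frac 0 z - b).
    rewrite /w1 !raddfB /= !phil0 eb loc_mapE.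
    have -> : frac 0 a = frac 0 (phi c) + frac 0 (phi y) + frac 0 (cx_d C' z)
        :> loc (cx_f C' l).
      by rewrite -!(raddfD (frac 0)) -addrA -eyz addrCA subrr addr0.
    set A := frac 0 _; set B := frac 0 (phi y); set D := frac 0 _.
    by rewrite -addrA -opprD -[A + B + D - _]addrA [LHS]addrC addKr.
  have hzb : loc_grading P' (q - 1 - 1) n (frac 0 z - b).
    by apply: loc_gradingB => //; exact: loc_grading_frac0.
  have [t ht et] := loc_qis_inj hw1 dw1 hzb ew1.
  exists (c + y, - t).
    split; first exact: (bgD gP).
    rewrite /= -sub0r; apply: loc_gradingB => //.
    by rewrite -(raddf0 (frac 0)); apply: loc_grading_frac0; exact: (bg0 gP).
  congr pair; rewrite /= raddfD /=; first by rewrite dy addr0.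
  by rewrite raddfN opprK -et /w1 -[w - _ - _]addrA -opprD [RHS]addrC subrK.
- move=> q n [v' w'] [/= hv' hw'] /cone_dE[/= dv' dw'].
  have [v [z [hv dv hz ev']]] := qis_surj qphi hv' dv'.
  (* The image of v/1 is a boundary, so v/1 is itself a boundary d y. What is left of [w'] after
     removing z/1 and the image of [y] is a cocycle, and lifts up to a boundary. *)
  have hw2 : loc_grading P' (q - 1) n (w' - frac 0 z).
    by apply: loc_gradingB => //; exact: loc_grading_frac0.
  have ew2 : phil (frac 0 v) = loc_d (w' - frac 0 z).
    rewrite phil0 raddfB /= loc_mapE; apply/eqP; rewrite eq_sym subr_eq -raddfD.
    by rewrite -ev' eq_sym -subr_eq0 dw'.
  have dv0 : loc_d (l := l) (frac 0 v) = 0 by rewrite loc_mapE dv raddf0.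
  have [y hy ey] := loc_qis_inj (loc_grading_frac0 _ hv) dv0 hw2 ew2.
  have hphy := loc_qis_P hy.
  have [t [r [ht dt hr er]]] : exists t r, [/\ loc_grading P (q - 1) n t,
      loc_d t = 0, loc_grading P' (q - 1 - 1) n r &
      w' - frac 0 z - phil y = phil t + loc_d r].
    apply: loc_qis_surj; first exact: loc_gradingB.
    by rewrite raddfB /= -ew2 ey (loc_qis_d hy) subrr.
  exists (v, y + t), (z, - r); split.
  + by split=> //; exact: loc_gradingD.
  + by apply/cone_dE; split=> //=; rewrite raddfD /= dt addr0 -ey subrr.
  + split=> //=; rewrite -sub0r; apply: loc_gradingB => //.
    by rewrite -(raddf0 (frac 0)); apply: loc_grading_frac0; exact: (bg0 gP').
  + congr pair; rewrite //= raddfN opprK raddfD /=.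
    rewrite addrACA -er -[w' - _ - _]addrA -opprD [phil y + _]addrC.
    by rewrite [RHS]addrC subrK.
Qed.

End ConeQis.

(** * Cones along divisible operators *)

Section TorsionQis.

Variables (l : L) (C : complex) (P : bigrading C).
Hypothesis gP : bigraded P.

Definition f_torsion (D : complex) (k : L) (v : D) : Prop :=
  exists N, iter N (cx_f D k) v = 0.

(* Divisibility by f up to f-torsion means that C -> C_f is onto, so that the
   cone is quasi-isomorphic to the kernel of C -> C_f. *)
Hypothesis div : forall q n v, P q (n + (e l)%:Z) v ->
  exists2 u, P q n u & f_torsion l (v - cx_f C l u).

Lemma loc_div q n w : loc_grading (l := l) P q n w ->
  exists2 u, P q n u & w = frac 0 u.
Proof.
move=> [k [v [-> hv]]]; elim: k v hv => [|k IH] v hv.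
  by exists v => //; rewrite muln0 addr0 in hv.
have [|u hu [N eN]] := @div q (n + (e l * k)%:Z) v.
  by move: hv; rewrite mulnS; congr (P q); lia.
have [u' hu' eu'] := IH u hu; exists u' => //; rewrite -eu' -[frac k u]fracS.
by apply/eqP; rewrite -subr_eq0 -raddfB; apply/eqP/frac_eq0; exists N.
Qed.

Definition torsion_incl (v : C) : cone l C := (v, 0).

Lemma torsion_incl_is_additive : zmod_morphism torsion_incl.
Proof. by move=> x y; congr pair; rewrite /= subr0. Qed.

HB.instance Definition _ :=
  GRing.isZmodMorphism.Build _ _ torsion_incl torsion_incl_is_additive.

Lemma torsion_qis :
  qis (fun q n v => P q n v /\ f_torsion l v) (cone_grading P) torsion_incl.
Proof.
split.
- by move=> l' v; congr pair; rewrite /= raddf0.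
- move=> q n v [hv tv]; split=> //=; rewrite -(raddf0 (frac 0)).
  by apply: loc_grading_frac0; exact: (bg0 gP).
- move=> q n v [hv tv]; congr pair; rewrite raddf0 subr0.
  by apply/esym/frac_eq0.
- move=> q n v [a b] [hv tv] dv [/= ha hb] [ea eb].
  have [u hu eu] := loc_div hb.
  (* The second component of the boundary equation says a/1 = d b with b = u/1. Subtracting d u
     makes [a] torsion and leaves d a unchanged. *)
  exists (a - cx_d C u); last by rewrite raddfB cx_dd subr0.
  split; first by apply: (bgB gP) => //; rewrite -(subrK 1 (q - 1)); exact: (bg_d gP).
  suff : frac 0 (a - cx_d C u) = 0 :> loc (cx_f C l) by move/frac_eq0.
  by rewrite raddfB [RHS]eb eu loc_mapE.
- move=> q n [v w] [/= hv hw] [dv dw].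
  have [u hu eu] := loc_div hw.
  exists (v - cx_d C u), (u, 0); split.
  + split; first by apply: (bgB gP) => //; rewrite -(subrK 1 q); exact: (bg_d gP).
    suff : frac 0 (v - cx_d C u) = 0 :> loc (cx_f C l) by move/frac_eq0.
    by rewrite raddfB -[RHS]dw eu loc_mapE.
  + by rewrite raddfB dv cx_dd subr0.
  + split=> //=; rewrite -(raddf0 (frac 0)).
    by apply: loc_grading_frac0; exact: (bg0 gP).
  + congr pair; rewrite /= ?subrK // raddf0 subr0 add0r //.
Qed.

End TorsionQis.

Fixpoint cech (ls : seq L) (C : complex) : complex :=
  if ls is l :: ls' then cech ls' (cone l C) else C.

Fixpoint cech_grading (ls : seq L) (C : complex) :
    bigrading C -> bigrading (cech ls C) :=
  match ls return bigrading C -> bigrading (cech ls C) with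
  | [::] => id
  | l :: ls' => fun P => cech_grading (cone_grading (l := l) P)
  end.
Arguments cech_grading ls {C} P.

Lemma cech_bigraded ls C (P : bigrading (cx_car C)) :
  bigraded P -> bigraded (cech_grading ls P).
Proof.
by elim: ls C P => [|l ls IH] C P gP //=; apply: IH; exact: cone_bigraded.
Qed.

Lemma cech_acyclic ls C C' (P : bigrading (cx_car C)) (P' : bigrading (cx_car C'))
    phi q n : bigraded P -> bigraded P' -> qis P P' phi ->
  acyclic (cech_grading ls P) q n <-> acyclic (cech_grading ls P') q n.
Proof.
elim: ls C C' P P' phi => [|l ls IH] C C' P P' phi gP gP' qphi /=.
  exact: qis_acyclic qphi.
apply: IH (cone_qis l gP gP' qphi); exact: cone_bigraded.
Qed.

Fixpoint all_torsion (ls : seq L) (C : complex) (v : C) : Prop :=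
  if ls is l :: ls' then f_torsion l v /\ all_torsion ls' v else True.

Lemma f_torsion_morph (C : complex) l (v : C) (phi : {additive C -> C}) :
  (forall v, phi (cx_f C l v) = cx_f C l (phi v)) ->
  f_torsion l v -> f_torsion l (phi v).
Proof. by move=> h [N eN]; exists N; rewrite -(morph_iter h) eN raddf0. Qed.

Lemma f_torsionB (C : complex) l (v w : C) :
  f_torsion l v -> f_torsion l w -> f_torsion l (v - w).
Proof.
move=> [N h] [N' h']; exists (N + N')%N.
by rewrite raddfB /= [iter _ _ w]iterD h' raddf0 addnC iterD h raddf0 subrr.
Qed.

Lemma f_torsion_bigraded (C : complex) l (P : bigrading C) : bigraded P ->
  bigraded (fun q n v => P q n v /\ f_torsion l v).
Proof.
move=> gP; split.
- by move=> q n; split; [exact: (bg0 gP) | exists 0%N].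
- move=> q n v w [hv tv] [hw tw]; split; first exact: (bgB gP).
  exact: f_torsionB.
- move=> q n v [hv tv]; split; first exact: (bg_d gP).
  exact: f_torsion_morph (@cx_df C l) tv.
- move=> q n l' v [hv tv]; split; first exact: (bg_f gP).
  by apply: f_torsion_morph tv => // w; rewrite cx_ff.
Qed.

End Complexes.

Arguments loc_d {L l C}.
Arguments cech_grading {L} e ls {C} P.

(** * Weyl algebra operators on Cech complexes *)

Section PairMap.

Variables (V W : zmodType) (phi : {additive V -> V}) (psi : {additive W -> W}).

Definition pair_map (x : V * W) : V * W := (phi x.1, psi x.2).

Lemma pair_map_is_additive : zmod_morphism pair_map.
Proof. by move=> x y; congr pair; rewrite /= raddfB. Qed.

HB.instance Definition _ :=
  GRing.isZmodMorphism.Build _ _ pair_map pair_map_is_additive.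

End PairMap.

Section WeylComplexes.

Variables (L : Type) (e : L -> nat) (B : comNzRingType) (gT : finGroupType).
Variables (actB derB : gT -> B -> B) (compB : int -> B -> Prop).
Variables (fB : L -> B) (avgB : B).

(* P is the bigrading of the whole complex, PS that of its G-invariants; the
   operator w_del g is the conjugate by g of a partial derivative. *)
Record weyl (C : complex L) (P PS : bigrading C) := Weyl {
  w_mul : B -> {additive C -> C};
  w_act : gT -> {additive C -> C};
  w_del : gT -> {additive C -> C};
  w_f : forall l v, cx_f C l v = w_mul (fB l) v;
  w_mulD : forall p q v, w_mul (p + q) v = w_mul p v + w_mul q v;
  w_mulM : forall p q v, w_mul (p * q) v = w_mul p (w_mul q v);
  w_mul1 : forall v, w_mul 1 v = v;
  w_actM : forall g h v, w_act (g * h)%g v = w_act g (w_act h v);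
  w_act_mul : forall g p v, w_act g (w_mul p v) = w_mul (actB g p) (w_act g v);
  w_act_del : forall h g v, w_act h (w_del g v) = w_del (h * g)%g (w_act h v);
  w_del_mul : forall g p v,
    w_del g (w_mul p v) = w_mul p (w_del g v) + w_mul (derB g p) v;
  w_delC : forall g h v, w_del g (w_del h v) = w_del h (w_del g v);
  w_d_mul : forall p v, cx_d C (w_mul p v) = w_mul p (cx_d C v);
  w_d_act : forall g v, cx_d C (w_act g v) = w_act g (cx_d C v);
  w_d_del : forall g v, cx_d C (w_del g v) = w_del g (cx_d C v);
  w_P_mul : forall q n k p v, compB k p -> P q n v -> P q (n + k) (w_mul p v);
  w_P_act : forall q n g v, P q n v -> P q n (w_act g v);
  w_P_del : forall q n g v, P q n v -> P q (n - 1) (w_del g v);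
  w_PS_P : forall q n v, PS q n v -> P q n v;
  w_PS_act : forall q n g v, PS q n v -> w_act g v = v;
  w_PS_avg : forall q n v, P q n v -> PS q n (w_mul avgB (\sum_g w_act g v)) }.

Hypothesis actB_f : forall g l, actB g (fB l) = fB l.
Hypothesis actB_der : forall h g p, actB h (derB g p) = derB (h * g)%g (actB h p).
Hypothesis derBC : forall g h p, derB g (derB h p) = derB h (derB g p).
Hypothesis compB_der : forall n g p, compB n p -> compB (n - 1) (derB g p).
Hypothesis compB_f : forall l, compB (e l)%:Z (fB l).

Section WeylCone.

Variables (l : L) (C : complex L) (P PS : bigrading C).
Hypotheses (gP : bigraded e P) (W : weyl P PS).

Lemma mul_f p v : w_mul W p (cx_f C l v) = cx_f C l (w_mul W p v).
Proof. by rewrite !(w_f W) -!w_mulM mulrC. Qed.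

Lemma act_f g v : w_act W g (cx_f C l v) = cx_f C l (w_act W g v).
Proof. by rewrite !(w_f W) w_act_mul actB_f. Qed.

Definition loc_mul p : {additive loc (cx_f C l) -> loc (cx_f C l)} :=
  loc_map (mul_f p).
Definition loc_act g : {additive loc (cx_f C l) -> loc (cx_f C l)} :=
  loc_map (act_f g).

Definition quotient_rule g k (v : C) : loc (cx_f C l) :=
  frac k (w_del W g v) - frac k.+1 (w_mul W (derB g (fB l)) v *+ k).

Lemma quotient_rule_is_additive g k : zmod_morphism (quotient_rule g k).
Proof.
move=> v w; rewrite /quotient_rule !raddfB mulrnBl raddfB /= !opprB addrACA.
by rewrite opprK addrACA [RHS]addrACA; congr (_ + _); rewrite addrC.
Qed.

HB.instance Definition _ g k :=
  GRing.isZmodMorphism.Build _ _ (quotient_rule g k)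
    (quotient_rule_is_additive g k).

Lemma quotient_ruleS g k v : quotient_rule g k.+1 (cx_f C l v) = quotient_rule g k v.
Proof.
rewrite /quotient_rule mul_f -raddfMn fracS.
rewrite [w_del W g _](_ : _ = cx_f C l (w_del W g v) + w_mul W (derB g (fB l)) v).
  rewrite raddfD /= fracS mulrS raddfD /= -addrA opprD; congr (_ + _).
  by rewrite addrA subrr add0r.
by rewrite !(w_f W) w_del_mul.
Qed.

Definition loc_del g : {additive loc (cx_f C l) -> loc (cx_f C l)} :=
  lift (quotient_ruleS g).

Lemma loc_delE g k v : loc_del g (frac k v) = quotient_rule g k v.
Proof. exact: (liftE (quotient_ruleS g)). Qed.

Lemma loc_mulE p k v : loc_mul p (frac k v) = frac k (w_mul W p v).
Proof. exact: loc_mapE. Qed.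

Lemma loc_actE g k v : loc_act g (frac k v) = frac k (w_act W g v).
Proof. exact: loc_mapE. Qed.

Lemma loc_act_del h g w : loc_act h (loc_del g w) = loc_del (h * g)%g (loc_act h w).
Proof.
have [k [v ->]] := fracP w.
rewrite loc_actE !loc_delE /quotient_rule raddfB !loc_actE.
by rewrite w_act_del raddfMn w_act_mul actB_der actB_f.
Qed.

Lemma loc_del_mul g p w :
  loc_del g (loc_mul p w) = loc_mul p (loc_del g w) + loc_mul (derB g p) w.
Proof.
have [k [v ->]] := fracP w.
rewrite !loc_mulE !loc_delE /quotient_rule raddfB !loc_mulE w_del_mul raddfD /=.
rewrite addrAC; congr (_ - frac _ _ + _).
by rewrite (raddfMn (w_mul W p)) -!w_mulM mulrC.
Qed.

(** The twofold quotient rule, once expanded, is symmetric in the two derivations, as they commute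
    on [C] and on [fB l]. *)
Lemma loc_delC g h w : loc_del g (loc_del h w) = loc_del h (loc_del g w).
Proof.
have [k [v ->]] := fracP w.
have E a b : loc_del a (loc_del b (frac k v)) =
    frac k (w_del W a (w_del W b v))
    - (frac k.+1 (w_mul W (derB a (fB l)) (w_del W b v))
       + frac k.+1 (w_mul W (derB b (fB l)) (w_del W a v))) *+ k
    - (frac k.+1 (w_mul W (derB a (derB b (fB l))) v)
       - frac k.+2 (w_mul W (derB a (fB l) * derB b (fB l)) v *+ k.+1)) *+ k.
  rewrite loc_delE /quotient_rule raddfB (raddfMn (frac _)).
  rewrite (raddfMn (loc_del _)) !loc_delE /quotient_rule w_del_mul -w_mulM.
  rewrite (raddfMn (frac k.+1)) raddfD /= -!addrA -!opprD -!mulrnDl.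
  by rewrite !addrA.
rewrite !E w_delC derBC [derB g (fB l) * _]mulrC.
by congr (_ - _ *+ _ - _); rewrite addrC.
Qed.

Lemma loc_d_del g (w : loc (cx_f C l)) :
  loc_d (loc_del g w) = loc_del g (loc_d w).
Proof.
have [k [u ->]] := fracP w.
have dE j x : loc_d (frac j x : loc (cx_f C l)) = frac j (cx_d C x).
  exact: loc_mapE.
rewrite loc_delE dE loc_delE /quotient_rule raddfB !dE w_d_del.
by rewrite raddfMn w_d_mul.
Qed.

Definition cone_mul p : {additive cone l C -> cone l C} :=
  pair_map (w_mul W p) (loc_mul p).
Definition cone_act g : {additive cone l C -> cone l C} :=
  pair_map (w_act W g) (loc_act g).
Definition cone_del g : {additive cone l C -> cone l C} :=
  pair_map (w_del W g) (loc_del g).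

Lemma cone_weyl : weyl (cone_grading e (l := l) P) (cone_grading e PS).
Proof.
exists cone_mul cone_act cone_del.
- move=> l' [v w]; congr pair; first exact: w_f.
  by have [k [u ->]] := fracP w; rewrite /= !loc_mapE (w_f W).
- move=> p q [v w]; congr pair; first exact: w_mulD.
  by have [k [u ->]] := fracP w; rewrite /= !loc_mapE w_mulD raddfD.
- move=> p q [v w]; congr pair; first exact: w_mulM.
  by have [k [u ->]] := fracP w; rewrite /= !loc_mapE w_mulM.
- move=> [v w]; congr pair; first exact: w_mul1.
  by have [k [u ->]] := fracP w; rewrite /= !loc_mapE w_mul1.
- move=> g h [v w]; congr pair; first exact: w_actM.
  by have [k [u ->]] := fracP w; rewrite /= !loc_mapE w_actM.
- move=> g p [v w]; congr pair; first exact: w_act_mul.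
  by have [k [u ->]] := fracP w; rewrite /= !loc_mapE w_act_mul.
- by move=> h g [v w]; congr pair; [exact: w_act_del | exact: loc_act_del].
- by move=> g p [v w]; congr pair; [exact: w_del_mul | exact: loc_del_mul].
- by move=> g h [v w]; congr pair; [exact: w_delC | exact: loc_delC].
- move=> p [v w]; congr pair; first exact: w_d_mul.
  have [k [u ->]] := fracP w.
  by rewrite /= raddfB /= !loc_mapE w_d_mul.
- move=> p [v w]; congr pair; first exact: w_d_act.
  have [k [u ->]] := fracP w.
  by rewrite /= raddfB /= !loc_mapE w_d_act.
- move=> g [v w]; congr pair; first exact: w_d_del.
  (* The derivation commutes with v |-> v/1 because the correction term of the quotient rule carries
     the factor k = 0. *)
  change (frac 0 (w_del W g v) - loc_d (loc_del g w) =
          loc_del g (frac 0 v - loc_d w)).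
  by rewrite raddfB loc_d_del loc_delE /quotient_rule mulr0n raddf0 subr0.
- move=> q n k p [v w] hp [hv [a [u [/= -> hu]]]].
  split; first exact: w_P_mul.
  rewrite /= loc_mapE; apply: loc_grading_frac; rewrite addrAC; exact: w_P_mul.
- move=> q n g [v w] [hv [a [u [/= -> hu]]]]; split; first exact: w_P_act.
  by rewrite /= loc_mapE; apply: loc_grading_frac; exact: w_P_act.
- move=> q n g [v w] [hv [a [u [/= -> hu]]]]; split; first exact: w_P_del.
  rewrite /= loc_delE; apply: loc_gradingB => //; apply: loc_grading_frac.
    by rewrite addrAC; exact: w_P_del.
  (* Writing e for [e l], the correction term has a numerator of degree n + e a + (e - 1) over
     f^(a+1), hence degree n - 1. *)
  rewrite -raddfMn (_ : _ - _ + _ = n + (e l * a)%:Z + ((e l)%:Z - 1)).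
    apply: w_P_mul; first exact: compB_der.
    exact: (bgMn gP).
  by rewrite mulnS; lia.
- move=> q n [v w] [hv [a [u [/= -> hu]]]]; split; first exact: (w_PS_P W).
  by apply: loc_grading_frac; exact: (w_PS_P W).
- move=> q n g [v w] [hv [a [u [/= -> hu]]]]; congr pair.
    exact: w_PS_act hv.
  by rewrite /= loc_mapE (w_PS_act _ _ hu).
- move=> q n [v w] [/= hv [a [u [-> hu]]]].
  rewrite (_ : \sum_g _ = (\sum_g w_act W g v, frac a (\sum_g w_act W g u))).
    split; first exact: (w_PS_avg W).
    by rewrite /= loc_mapE; apply: loc_grading_frac; exact: w_PS_avg.
  rewrite raddf_sum; elim/big_rec3: _ => // g x y _ _ ->.
  by congr pair; rewrite /= loc_mapE.
Qed.

End WeylCone.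

Lemma cech_weyl ls C (P PS : bigrading (cx_car C)) :
  bigraded e P -> bigraded e PS -> weyl P PS ->
  inhabited (weyl (cech_grading e ls P) (cech_grading e ls PS)).
Proof.
elim: ls C P PS => [|l ls IH] C P PS gP gPS W; first by exists.
by apply: IH; [exact: cone_bigraded | exact: cone_bigraded | exact: cone_weyl].
Qed.

End WeylComplexes.

(** * Nilpotency and vanishing *)

Section ElementarySymmetric.

Variables (T : eqType) (V : zmodType) (op : T -> {additive V -> V}).
Hypothesis opC : forall g h v, op g (op h v) = op h (op g v).

(* The i-th elementary symmetric function of the operators op g, g in s. *)
Fixpoint elsym (s : seq T) (i : nat) (v : V) : V :=
  if s is g :: s' then
    elsym s' i v + (if i is j.+1 then op g (elsym s' j v) else 0)
  else if i is 0 then v else 0.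

Lemma elsym0 s v : elsym s 0 v = v.
Proof. by elim: s => [|g s IH] //=; rewrite IH addr0. Qed.

Lemma elsym_gt s i v : (size s < i)%N -> elsym s i v = 0.
Proof.
elim: s i => [|g s IH] [|i] //= hi; rewrite !IH ?raddf0 ?addr0 //.
exact: ltnW.
Qed.

Lemma elsym_swap g h s i v : elsym (g :: h :: s) i v = elsym (h :: g :: s) i v.
Proof.
case: i => [|[|i]] //=; rewrite -!addrA; congr (_ + _).
  by rewrite !addr0 addrC.
rewrite !raddfD /= (opC g h) !addrA; congr (_ + _); exact: addrC.
Qed.

Lemma elsym_rem g s i v : g \in s -> elsym s i v = elsym (g :: rem g s) i v.
Proof.
elim: s i => [|h s IH] i //; rewrite in_cons => /orP[/eqP->|gs] /=.
  by rewrite eqxx.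
case: eqP => [-> //|/eqP ngh]; rewrite [RHS]elsym_swap /= IH //.
by case: i => [|i] //; rewrite IH.
Qed.

Lemma elsym_perm s s' i v : perm_eq s s' -> elsym s i v = elsym s' i v.
Proof.
elim: s s' i => [|g s IH] s' i.
  by move=> /perm_size/esym/size0nil ->.
move=> hs; have gs' : g \in s' by rewrite -(perm_mem hs) mem_head.
have ps : perm_eq s (rem g s').
  by rewrite -(perm_cons g); apply: perm_trans hs _; exact: perm_to_rem.
by rewrite (elsym_rem i v gs') /= (IH _ _ ps); case: i => // j; rewrite (IH _ _ ps).
Qed.

Lemma op_iterC g h k v : op g (iter k (op h) v) = iter k (op h) (op g v).
Proof. by elim: k => [|k IH] //=; rewrite opC IH. Qed.

(** The product of the t - [op g] over [s], evaluated at t = [op h]. Working on vectors avoids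
    constructing a commutative ring of operators. *)
Definition vieta h s v := foldr (fun g w => op h w - op g w) v s.

Lemma vieta0 h s v : h \in s -> vieta h s v = 0.
Proof.
elim: s => [|k s IH] //; rewrite in_cons /= => /orP[/eqP->|hs].
  by rewrite subrr.
by rewrite IH // !raddf0 addr0.
Qed.

(** The two summands of the recursion for [elsym] match the two terms of [op h w - op g w], up to a
    shift of the index; the extra top term vanishes by [elsym_gt]. *)
Lemma vietaE h s v : vieta h s v =
  \sum_(i < (size s).+1) iter (size s - i) (op h) (elsym s i v) *~ (-1) ^+ i.
Proof.
elim: s => [|g s IH]; first by rewrite big_ord1 /= expr0.
rewrite [LHS]/= IH !raddf_sum /=.
rewrite [RHS](eq_bigr (fun i : 'I_(size s).+2 =>
    iter ((size s).+1 - i) (op h) (elsym s i v) *~ (-1) ^+ i +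
    iter ((size s).+1 - i) (op h)
      (if nat_of_ord i is j.+1 then op g (elsym s j v) else 0) *~ (-1) ^+ i)).
  rewrite big_split; congr (_ + _).
    rewrite [RHS]big_ord_recr /= elsym_gt // raddf0 mul0rz addr0.
    by apply: eq_bigr => i _; rewrite raddfMz -iterS subSn // -ltnS.
  rewrite [RHS]big_ord_recl /= !raddf0 mul0rz add0r; apply: eq_bigr => i _.
  rewrite /bump leq0n add1n subSS raddfMz op_iterC exprS mulN1r mulrNz.
  by [].
by move=> i _; rewrite -mulrzDl -raddfD.
Qed.

End ElementarySymmetric.

Section WeylAcyclic.

Variables (L : Type) (e : L -> nat) (B : comNzRingType) (gT : finGroupType).
Variables (actB derB : gT -> B -> B) (compB : int -> B -> Prop).
Variables (fB : L -> B) (avgB x0 : B).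
Hypothesis compB_act : forall n g p, compB n p -> compB n (actB g p).
Hypothesis actBM : forall g h p, actB (g * h)%g p = actB g (actB h p).
Hypothesis actB1 : forall p, actB 1%g p = p.
Hypothesis avgB_card : avgB *+ #|gT| = 1.
Hypothesis natB_inv : forall c : nat, exists2 b, compB 0 b & b *+ c.+1 = 1.
Hypothesis compB_x0 : compB 1 x0.
Hypothesis derB_x0 : derB 1%g x0 = 1.

Variables (C : complex L) (P PS : bigrading C).
Hypothesis gP : bigraded e P.
Variable W : weyl actB derB compB fB avgB P PS.
Variable q : int.

Definition bounds n (v : C) : Prop := exists2 w, P (q - 1) n w & v = cx_d C w.

Lemma bounds0 n : bounds n 0.
Proof. by exists 0; rewrite ?raddf0 //; exact: (bg0 gP). Qed.

Lemma boundsB n v w : bounds n v -> bounds n w -> bounds n (v - w).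
Proof.
move=> [a ha ->] [b hb ->]; exists (a - b); rewrite ?raddfB //.
exact: (bgB gP).
Qed.

Lemma boundsN n v : bounds n v -> bounds n (- v).
Proof. by move=> h; rewrite -sub0r; apply: boundsB => //; exact: bounds0. Qed.

Lemma boundsD n v w : bounds n v -> bounds n w -> bounds n (v + w).
Proof. by move=> hv hw; rewrite -[w]opprK; apply/boundsB/boundsN. Qed.

Lemma bounds_mul n k p v : compB k p -> bounds n v -> bounds (n + k) (w_mul W p v).
Proof.
move=> hp [w hw ->]; exists (w_mul W p w); first exact: w_P_mul.
by rewrite w_d_mul.
Qed.

Lemma bounds_del n g v : bounds n v -> bounds (n - 1) (w_del W g v).
Proof.
move=> [w hw ->]; exists (w_del W g w); first exact: w_P_del.
by rewrite w_d_del.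
Qed.

Lemma bounds_mulrz n v (k : int) : bounds n v -> bounds n (v *~ k).
Proof.
move=> h; have hn j : bounds n (v *+ j).
  elim: j => [|j IH]; first exact: bounds0.
  by rewrite mulrS; exact: boundsD.
by case: k => j; [exact: hn | apply: boundsN; exact: hn].
Qed.

Lemma mulB_mulrn p k v : w_mul W (p *+ k) v = w_mul W p v *+ k.
Proof.
elim: k => [|k IH]; last by rewrite !mulrS w_mulD IH.
by apply: (addrI (w_mul W 0 v)); rewrite mulr0n -w_mulD !addr0.
Qed.

Lemma bounds_divn n c v : bounds n (v *+ c.+1) -> bounds n v.
Proof.
have [b hb b1] := natB_inv c => hv.
have := bounds_mul hb hv; rewrite addr0 raddfMn /=.
by rewrite -mulB_mulrn b1 w_mul1.
Qed.

Section Nilpotency.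

Variables (op : gT -> {additive C -> C}) (s : int).
Hypothesis s_sign : s = 1 \/ s = -1.
Hypothesis opC : forall g h v, op g (op h v) = op h (op g v).
Hypothesis act_op : forall h g v,
  w_act W h (op g v) = op (h * g)%g (w_act W h v).
Hypothesis d_op : forall g v, cx_d C (op g v) = op g (cx_d C v).
Hypothesis P_op : forall k n g v, P k n v -> P k (n + s) (op g v).

Lemma act_elsym h t i v :
  w_act W h (elsym op t i v) = elsym op (map (mulg h) t) i (w_act W h v).
Proof.
elim: t i => [|g t IH] [|i] //=; rewrite ?raddf0 //.
  by rewrite !addr0 IH.
by rewrite raddfD /= IH act_op IH.
Qed.

(** Left translation by [h] permutes the whole group, and [elsym] does not depend on the order of
    the list. *)
Lemma elsym_invariant i v : (forall h, w_act W h v = v) ->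
  forall h, w_act W h (elsym op (enum gT) i v) = elsym op (enum gT) i v.
Proof.
move=> hv h; rewrite act_elsym hv; apply: elsym_perm => //.
apply: uniq_perm; [|exact: enum_uniq|move=> g].
  by rewrite map_inj_uniq; [exact: enum_uniq | exact: mulgI].
rewrite mem_enum; apply/mapP; exists (h^-1 * g)%g.
  by rewrite mem_enum.
by rewrite mulKVg.
Qed.

Lemma d_elsym t i v : cx_d C (elsym op t i v) = elsym op t i (cx_d C v).
Proof.
elim: t i => [|g t IH] [|i] //=; rewrite ?raddf0 //.
  by rewrite !addr0 IH.
by rewrite raddfD /= IH d_op IH.
Qed.

Lemma elsym0r t i : elsym op t i 0 = 0.
Proof.
by elim: t i => [|g t IH] [|i] //=; rewrite ?IH ?raddf0 addr0.
Qed.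

Lemma P_elsym k n t i v : P k n v -> P k (n + s * i%:Z) (elsym op t i v).
Proof.
move=> hv; elim: t i => [|g t IH] [|i] /=.
- by rewrite mulr0 addr0.
- exact: (bg0 gP).
- by rewrite addr0.
- apply: (bgD gP) => //.
  rewrite (_ : n + _ = n + s * i%:Z + s); first exact: P_op.
  by rewrite intS mulrDr mulr1; lia.
Qed.

(** The structure only places averages in [PS]; an invariant element equals its own average. *)
Lemma average k n v : P k n v -> (forall g, w_act W g v = v) -> PS k n v.
Proof.
move=> hv inv; have := w_PS_avg W hv.
rewrite (eq_bigr (fun=> v)) // sumr_const.
by rewrite raddfMn -mulB_mulrn avgB_card w_mul1.
Qed.

Lemma bounds_op n k h v : bounds n v -> bounds (n + s * k%:Z) (iter k (op h) v).
Proof.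
move=> [w hw ->]; exists (iter k (op h) w); last first.
  by elim: k => [|k IH] //=; rewrite IH d_op.
elim: k => [|k IH] /=; first by rewrite mulr0 addr0.
rewrite (_ : n + _ = n + s * k%:Z + s); first exact: P_op.
by rewrite intS mulrDr mulr1; lia.
Qed.

Variable N : nat.
Hypothesis acyc : forall n : int, (N%:Z < `|n|) -> acyclic PS q n.

(* op 1 is integral over the elementary symmetric functions of the op g, which
   preserve invariants and move the degree towards the vanishing range. *)
Lemma op_nilpotent t n u : (N%:Z < s * n + t%:Z) -> PS q n u -> cx_d C u = 0 ->
  bounds (n + s * (#|gT| * t)%:Z) (iter (#|gT| * t) (op 1%g) u).
Proof.
elim: t n u => [|t IH] n u hn hu du.
  rewrite muln0 mulr0 addr0; have [|w hw ->] := acyc _ hu du.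
    by case: s_sign hn => ->; lia.
  by exists w => //; exact: (w_PS_P W).
(* The factor at g = 1 kills the product. Its leading term then expresses the |G|-th power of [op 1]
   on [u] through lower powers applied to symmetric functions of index at least 1. *)
have : vieta op 1%g (enum gT) u = 0 by apply: vieta0 => //; rewrite mem_enum.
rewrite vietaE // -cardE big_ord_recl /= subn0 elsym0 expr0 mulr1z.
move/eqP; rewrite addr_eq0 => /eqP eu.
rewrite mulnS addnC iterD eu raddfN; apply: boundsN.
rewrite raddf_sum; apply: big_ind => [||i _]; first exact: bounds0.
  exact: boundsD.
rewrite raddfMz /= -iterD /bump leq0n add1n.
apply: bounds_mulrz; set c := elsym _ _ _ _.
(* [c] is an invariant cocycle, and s times its degree exceeds s n by at least 1, so the induction
   hypothesis for [t] applies. The remaining powers of [op 1] are restored by [bounds_op]. *)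
have hc : PS q (n + s * i.+1%:Z) c.
  apply: average; first by apply: P_elsym; exact: (w_PS_P W).
  by apply: elsym_invariant => h; exact: w_PS_act hu.
have dc : cx_d C c = 0 by rewrite d_elsym du elsym0r.
have := IH _ _ _ hc dc; case.
  by case: s_sign hn => ->; lia.
move=> w hw ew.
have := bounds_op (#|gT| - i.+1) 1%g (ex_intro2 _ _ w hw ew).
rewrite -iterD addnC.
rewrite (_ : n + s * i.+1%:Z + s * (#|gT| * t)%N%:Z + s * (#|gT| - i.+1)%N%:Z =
  n + s * (#|gT| * t + #|gT|)%N%:Z) //.
have hi : (i < #|gT|)%N by [].
by rewrite -!addrA -!mulrDr; congr (_ + _ * _); lia.
Qed.

End Nilpotency.

Definition op_X g : {additive C -> C} := w_mul W (actB g x0).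

Lemma bounds_iter_del n k v : bounds n v -> bounds (n - k%:Z) (iter k (w_del W 1%g) v).
Proof.
move=> hv; elim: k => [|k IH] /=; first by rewrite subr0.
rewrite (_ : n - _ = n - k%:Z - 1); last by lia.
exact: bounds_del.
Qed.

Lemma del_iter_X c v : iter c.+1 (w_del W 1%g) (op_X 1%g v) =
  op_X 1%g (iter c.+1 (w_del W 1%g) v) + iter c (w_del W 1%g) v *+ c.+1.
Proof.
have E u : w_del W 1%g (op_X 1%g u) = op_X 1%g (w_del W 1%g u) + u.
  by rewrite /op_X actB1 w_del_mul derB_x0 w_mul1.
elim: c => [|c IH]; first exact: E.
rewrite [LHS]iterS IH raddfD E raddfMn /= -addrA -mulrS.
by [].
Qed.

(** Write X, D for the two operators. Since D^(c+1) X v = X D^(c+1) v + (c+1) D^c v, the hypotheses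
    pass from v to X v with b lowered and c raised, so that X v becomes a boundary. The same
    relation then shows that (c+1) D^c v is a boundary; dividing by c+1, c descends to 0. *)
Lemma bounds_weyl b c n v : bounds (n + b%:Z) (iter b (op_X 1%g) v) ->
  bounds (n - c%:Z) (iter c (w_del W 1%g) v) -> bounds n v.
Proof.
elim: b c n v => [|b IHb] c n v hX hD; first by rewrite addr0 in hX.
have {hX IHb} hX : bounds (n + 1) (op_X 1%g v).
  apply: (IHb c.+1).
    by rewrite -iterSr; move: hX; congr bounds; lia.
  rewrite del_iter_X; apply: boundsD.
    rewrite (_ : n + 1 - _ = n - c%:Z - 1 + 1); last by lia.
    by apply: bounds_mul; [exact: compB_act | exact: bounds_del].
  rewrite (_ : n + 1 - _ = n - c%:Z); last by lia.
  by have := bounds_mulrz c.+1%:Z hD.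
elim: c hD => [|c IHc] hD; first by rewrite subr0 in hD.
apply: IHc; apply: (@bounds_divn _ c).
have := bounds_iter_del c.+1 hX; rewrite del_iter_X => h.
have hXD : bounds (n - c.+1%:Z + 1) (op_X 1%g (iter c.+1 (w_del W 1%g) v)).
  by apply: bounds_mul hD; exact: compB_act.
rewrite (_ : _ - _ = n - c.+1%:Z + 1); last by lia.
have -> : iter c (w_del W 1%g) v *+ c.+1 =
    op_X 1%g (iter c.+1 (w_del W 1%g) v) + iter c (w_del W 1%g) v *+ c.+1
    - op_X 1%g (iter c.+1 (w_del W 1%g) v) by rewrite addrC addKr.
by apply: boundsB => //; move: h; congr bounds; lia.
Qed.

Lemma weyl_acyclic (N : nat) :
  (forall n : int, (N%:Z < `|n|) -> acyclic PS q n) ->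
  forall n, acyclic PS q n.
Proof.
move=> acyc n u hu du.
have [w hw eu] : bounds n u.
  (* Large enough to reach the vanishing range from degree n in either direction. *)
  pose t := (N + `|n| + 1)%N.
  apply: (@bounds_weyl (#|gT| * t) (#|gT| * t)).
    have := @op_nilpotent op_X 1 (or_introl erefl) _ _ _ _ N acyc t n u.
    rewrite !mul1r; apply=> //.
    - by move=> g h v; rewrite /op_X -!w_mulM mulrC.
    - by move=> h g v; rewrite /op_X w_act_mul actBM.
    - by move=> g v; rewrite /op_X w_d_mul.
    - by move=> k a g v; apply: w_P_mul; exact: compB_act.
    - by rewrite /t; lia.
  have := @op_nilpotent (w_del W) (-1) (or_intror erefl) _ _ _ _ N acyc t n u.
  rewrite !mulN1r; apply=> //.
  - exact: w_delC.
  - exact: w_act_del.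
  - exact: w_d_del.
  - exact: w_P_del.
  - by rewrite /t; lia.
(* [w] bounds [u] only in the large complex; its average is graded in [PS] and still bounds [u],
   which is invariant. *)
exists (w_mul W avgB (\sum_g w_act W g w)); first exact: w_PS_avg.
rewrite w_d_mul raddf_sum (eq_bigr (fun=> u)) => [|g _].
  by rewrite sumr_const raddfMn -mulB_mulrn avgB_card w_mul1.
by rewrite /= w_d_act -eu; exact: w_PS_act hu.
Qed.

End WeylAcyclic.

(** * Noetherianity *)

Section Span.

Variable R : comNzRingType.
Implicit Types (s t : seq R) (x y : R) (J : R -> Prop).

(** The ideal generated by [s], recursive so that inductions peel off one generator without indexed
    families of coefficients. *)
Fixpoint span s x : Prop :=
  if s is a :: s' then exists c, span s' (x - c * a) else x = 0.

Lemma span0 s : span s 0.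
Proof. by elim: s => //= a s IH; exists 0; rewrite mul0r subr0. Qed.

Lemma spanD s x y : span s x -> span s y -> span s (x + y).
Proof.
elim: s x y => [|a s IH] x y /=; first by move=> -> ->; rewrite addr0.
by move=> [c hc] [d hd]; exists (c + d); rewrite mulrDl opprD addrACA; exact: IH.
Qed.

Lemma spanM s b x : span s x -> span s (b * x).
Proof.
elim: s x => [|a s IH] x /=; first by move=> ->; rewrite mulr0.
by move=> [c hc]; exists (b * c); rewrite -mulrA -mulrBr; exact: IH.
Qed.

Lemma span_mem s x : x \in s -> span s x.
Proof.
elim: s => //= a s IH; rewrite in_cons => /orP[/eqP->|h].
  by exists 1; rewrite mul1r subrr; exact: span0.
by exists 0; rewrite mul0r subr0; exact: IH.
Qed.

Lemma span_ideal J s x : is_ideal J -> {in s, forall a, J a} -> span s x -> J x.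
Proof.
move=> [J0 JD JM]; elim: s x => [|a s IH] x hs /=; first by move=> ->.
move=> [c /IH h]; rewrite -(subrK (c * a) x); apply: JD.
  by apply: h => b hb; apply: hs; rewrite in_cons hb orbT.
by apply/JM/hs; rewrite mem_head.
Qed.

Lemma spanP s : is_ideal (span s).
Proof. by split; [exact: span0 | exact: spanD | exact: spanM]. Qed.

Lemma span_trans s t x : {in s, forall a, span t a} -> span s x -> span t x.
Proof. by move=> h; apply: span_ideal h; exact: spanP. Qed.

Lemma span_catl s t x : span s x -> span (s ++ t) x.
Proof. by apply: span_trans => a h; apply: span_mem; rewrite mem_cat h. Qed.

Lemma span_catr s t x : span t x -> span (s ++ t) x.
Proof. by apply: span_trans => a h; apply: span_mem; rewrite mem_cat h orbT. Qed.

Lemma span_sum s x : span s x ->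
  exists c : 'I_(size s) -> R, x = \sum_j c j * s`_j.
Proof.
elim: s x => [|a s IH] x /=; first by exists (fun=> 0); rewrite big_ord0.
move=> [c /IH[d ed]].
exists (fun j => if unlift ord0 j is Some i then d i else c).
rewrite big_ord_recl unlift_none /=.
rewrite (eq_bigr (fun i => d i * s`_i)) => [|i _]; last by rewrite liftK.
by rewrite -ed addrC subrK.
Qed.

Lemma noetherianP : noetherian R <->
  forall J, is_ideal J ->
    exists s, {in s, forall a, J a} /\ forall x, J x -> span s x.
Proof.
split=> noethR J iJ.
  have [k [g [Jg gJ]]] := noethR J iJ.
  exists [seq g j | j : 'I_k]; split=> [a /imageP[j _ ->]|x /gJ[c ->]].
    exact: Jg.
  have [h0 hD hM] := spanP [seq g j | j : 'I_k].
  elim/big_ind: _ => // j _; apply/hM/span_mem.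
  by apply/imageP; exists j.
have [s [sJ Js]] := noethR J iJ.
exists (size s), (fun j => s`_j); split=> [j|x /Js/span_sum//].
exact/sJ/mem_nth.
Qed.

End Span.

Lemma noetherian_surj (R R' : comNzRingType) (phi : {rmorphism R -> R'}) :
  (forall y, exists x, phi x = y) -> noetherian R -> noetherian R'.
Proof.
move=> phi_surj nR J [J0 JD JM].
have [|k [g [Jg gJ]]] := nR (fun x => J (phi x)).
  split; first by rewrite rmorph0.
    by move=> x y hx hy; rewrite rmorphD; exact: JD.
  by move=> a x hx; rewrite rmorphM; exact: JM.
exists k, (phi \o g); split=> // y; have [x <-] := phi_surj y.
move=> /gJ[c ->]; exists (phi \o c); rewrite rmorph_sum.
by apply: eq_bigr => j _; rewrite rmorphM.
Qed.

(** An ideal of S is extended to R, where finitely many of its own elements generate the extension;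
    the S-linear retraction [rho] carries the resulting expressions back to S. *)
Lemma noetherian_retract (S R : comNzRingType) (iota : {rmorphism S -> R})
    (rho : {additive R -> S}) : rho 1 = 1 ->
  (forall s r, rho (r * iota s) = rho r * s) -> noetherian R -> noetherian S.
Proof.
move=> rho1 rhoM /noetherianP nR; apply/noetherianP => J iJ.
pose JR x := exists s, {in s, forall a, J a} /\ span (map iota s) x.
have [|s [sJR JRs]] := nR JR.
  split; first by exists [::].
    move=> x y [s [hs sx]] [t [ht ty]]; exists (s ++ t); split.
      by move=> a; rewrite mem_cat => /orP[/hs|/ht].
    rewrite map_cat; apply: spanD; [exact: span_catl | exact: span_catr].
  by move=> a x [s [hs sx]]; exists s; split=> //; exact: spanM.
(* The generators of the extended ideal lie in R; each is replaced by the finitely many elements of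
   [J] that express it. *)
have [t [tJ st]] : exists t, {in t, forall a, J a} /\
    {in s, forall x, span (map iota t) x}.
  elim: s sJR {JRs} => [|x s IH] sJR; first by exists [::].
  have [t [tJ st]] : exists t, {in t, forall a, J a} /\
      {in s, forall x, span (map iota t) x}.
    by apply: IH => a ha; apply: sJR; rewrite in_cons ha orbT.
  have [t' [t'J xt']] := sJR x (mem_head _ _).
  exists (t' ++ t); split.
    by move=> a; rewrite mem_cat => /orP[/t'J|/tJ].
  move=> a; rewrite map_cat in_cons => /orP[/eqP->|/st h].
    exact: span_catl.
  exact: span_catr.
exists t; split=> // x Jx.
have {s sJR JRs st} : span (map iota t) (iota x).
  apply: span_trans st _; apply: JRs; exists [:: x]; split.
    by move=> a; rewrite inE => /eqP->.
  by apply: span_mem; rewrite mem_head.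
suff H y : span (map iota t) y -> span t (rho y).
  by move=> /H; rewrite -[iota x]mul1r rhoM rho1 mul1r.
elim: t y {tJ} => [|a t IH] y /=; first by move=> ->; rewrite raddf0.
by move=> [c /IH h]; exists (rho c); rewrite -rhoM -raddfB.
Qed.

(** * Hilbert's basis theorem *)

Section Hilbert.

Variable A : comNzRingType.
Hypothesis nA : noetherian A.
Variable J : {poly A} -> Prop.
Hypothesis iJ : is_ideal J.

Definition lead_ideal n a := exists p, [/\ J p, (size p <= n.+1)%N & p`_n = a].

Lemma lead_idealP n : is_ideal (lead_ideal n).
Proof.
have [J0 JD JM] := iJ; split.
- by exists 0; rewrite size_poly0 coef0.
- move=> a b [p [Jp sp <-]] [q [Jq sq <-]]; exists (p + q); rewrite coefD.
  split=> //; first exact: JD.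
  by apply: leq_trans (size_polyD _ _) _; rewrite geq_max sp.
- move=> c a [p [Jp sp <-]]; exists (c%:P * p); rewrite coefCM; split=> //.
    exact: JM.
  by rewrite mul_polyC; apply: leq_trans (size_scale_leq _ _) sp.
Qed.

Lemma lead_ideal_le n k a : (n <= k)%N -> lead_ideal n a -> lead_ideal k a.
Proof.
have [_ _ JM] := iJ; move=> /subnKC <-; move: (k - n)%N => {}k [p [Jp sp <-]].
exists ('X^k * p); rewrite coefXnM ltnNge leq_addl addnK; split=> //.
  exact: JM.
apply: leq_trans (size_polyMleq _ _) _.
by rewrite size_polyXn addSn /= addnC -addSn leq_add2r.
Qed.

(** One list serves all degrees k >= n, since multiplication by X^(k-n) moves a leading coefficient
    from degree n to degree k. *)
Lemma lead_ideal_gen n : exists s, {in s, forall p, J p} /\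
  forall k a, (n <= k)%N -> lead_ideal n a ->
    exists q, [/\ span s q, (size q <= k.+1)%N & q`_k = a].
Proof.
have /noetherianP := nA; move=> /(_ _ (lead_idealP n))[t [tL Lt]].
have [s [sJ st]] : exists s : seq {poly A}, {in s, forall p, J p} /\
    forall k a, (n <= k)%N -> span t a ->
    exists q, [/\ span s q, (size q <= k.+1)%N & q`_k = a].
  elim: t tL {Lt} => [|b t IH] tL.
    exists [::]; split=> // k a _ ->; exists 0.
    by rewrite size_poly0 coef0.
  have [s [sJ st]] : exists s : seq {poly A}, {in s, forall p, J p} /\
      forall k a, (n <= k)%N -> span t a ->
      exists q, [/\ span s q, (size q <= k.+1)%N & q`_k = a].
    by apply: IH => a ha; apply: tL; rewrite in_cons ha orbT.
  have [p [Jp sp ep]] := tL b (mem_head _ _).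
  exists (p :: s); split.
    by move=> a; rewrite in_cons => /orP[/eqP->|/sJ].
  move=> k a nk [c /st -/(_ k nk)[q [sq hq eq]]].
  exists (q + c%:P * 'X^(k - n) * p); split.
  - exists (c%:P * 'X^(k - n)); by rewrite addrK.
  - apply: leq_trans (size_polyD _ _) _; rewrite geq_max hq -mulrA mul_polyC.
    apply: leq_trans (size_scale_leq _ _) _.
    apply: leq_trans (size_polyMleq _ _) _.
    rewrite size_polyXn addSn /=; apply: leq_trans (leq_add (leqnn _) sp) _.
    by rewrite addnS subnK.
  - rewrite coefD -mulrA coefCM coefXnM ltnNge leq_subr /= subKn // ep eq.
    by rewrite subrK.
by exists s; split=> // k a nk /Lt; exact: st.
Qed.

Lemma lead_ideal_stable : exists N, forall n a, lead_ideal n a -> lead_ideal N a.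
Proof.
have iL : is_ideal (fun a => exists n, lead_ideal n a).
  split.
  - by exists 0%N; have [] := lead_idealP 0.
  - move=> a b [n ha] [k hb]; exists (maxn n k).
    have [_ LD _] := lead_idealP (maxn n k); apply: LD.
      exact: lead_ideal_le (leq_maxl _ _) ha.
    exact: lead_ideal_le (leq_maxr _ _) hb.
  - by move=> c a [n ha]; exists n; have [_ _ LM] := lead_idealP n; exact: LM.
have /noetherianP := nA; move=> /(_ _ iL)[s [sL Ls]].
have [N hN] : exists N, {in s, forall a, lead_ideal N a}.
  elim: s sL {Ls} => [|b s IH] sL; first by exists 0%N.
  have [N hN] : exists N, {in s, forall a, lead_ideal N a}.
    by apply: IH => a ha; apply: sL; rewrite in_cons ha orbT.
  have [n hn] := sL b (mem_head _ _).
  exists (maxn n N) => a; rewrite in_cons => /orP[/eqP->|/hN].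
    exact: lead_ideal_le (leq_maxl _ _) hn.
  exact: lead_ideal_le (leq_maxr _ _).
exists N => n a ha; apply: span_ideal (lead_idealP N) hN _.
by apply: Ls; exists n.
Qed.

Lemma hilbert_fg : exists s, {in s, forall p, J p} /\ forall p, J p -> span s p.
Proof.
have [N hN] := lead_ideal_stable.
have [s [sJ hs]] : exists s, {in s, forall p, J p} /\
    forall n k a, (n <= N)%N -> (n <= k)%N -> lead_ideal n a ->
      exists q, [/\ span s q, (size q <= k.+1)%N & q`_k = a].
  elim: {-2}N (leqnn N) => [|M IH] hM.
    have [s [sJ hs]] := lead_ideal_gen 0; exists s; split=> // n k a.
    by rewrite leqn0 => /eqP->; exact: hs.
  have [s [sJ hs]] := IH (ltnW hM).
  have [t [tJ ht]] := lead_ideal_gen M.+1.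
  exists (s ++ t); split.
    by move=> p; rewrite mem_cat => /orP[/sJ|/tJ].
  move=> n k a; rewrite leq_eqVlt => /orP[/eqP->|]; last rewrite ltnS.
    by move=> hk /(ht _ _ hk)[q [h1 h2 h3]]; exists q; split=> //; exact: span_catr.
  move=> hn hk /(hs _ _ _ hn hk)[q [h1 h2 h3]].
  by exists q; split=> //; exact: span_catl.
exists s; split=> // p; move: {2}(size p) (leqnn (size p)) => m.
elim: m p => [|m IH] p hp Jp.
  by move: hp; rewrite leqn0 size_poly_eq0 => /eqP->; exact: span0.
have La : lead_ideal m p`_m by exists p.
(* Below [N] the leading coefficient is matched in its own degree; above [N] it already occurs in
   degree [N]. *)
have [q [sq hq eq]] : exists q, [/\ span s q, (size q <= m.+1)%N & q`_m = p`_m].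
  by case: (leqP m N) => mN; [exact: hs La | exact: hs (ltnW mN) (hN _ _ La)].
have [_ JD JM] := iJ.
rewrite -(subrK q p); apply: spanD => //; apply: IH.
  apply/leq_sizeP => j; rewrite leq_eqVlt coefB => /orP[/eqP<-|hj].
    by rewrite eq subrr.
  by rewrite !nth_default ?subrr //; [exact: leq_trans hq hj | exact: leq_trans hp hj].
apply: JD => //; rewrite -mulN1r; apply: JM; exact: span_ideal iJ sJ sq.
Qed.

End Hilbert.

Lemma noetherian_poly (A : comNzRingType) : noetherian A -> noetherian {poly A}.
Proof. by move=> nA; apply/noetherianP => J iJ; exact: hilbert_fg. Qed.

Lemma mpoly_ring_ind (A : comNzRingType) m (Q : {mpoly A[m]} -> Prop) :
  (forall c, Q c%:MP) -> (forall i, Q 'X_i) ->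
  (forall p q, Q p -> Q q -> Q (p + q)) -> (forall p q, Q p -> Q q -> Q (p * q)) ->
  forall p, Q p.
Proof.
move=> QC QX QD QM; elim/mpolyind => [|c k p _ _ Qp].
  by have := QC 0; rewrite mpolyC0.
apply: QD Qp; rewrite -mul_mpolyC; apply: (QM) => //; rewrite mpolyXE_id.
elim/big_ind: _ => [|a b|i _]; [exact: (QC 1) | exact: QM |].
elim: (k i) => [|j IH]; first exact: (QC 1).
by rewrite exprS; exact: QM.
Qed.

Lemma noetherian_mpoly (A : comNzRingType) m :
  noetherian A -> noetherian {mpoly A[m]}.
Proof.
move=> nA; elim: m => [|m IH].
  apply: (@noetherian_surj A _ (@mpolyC 0 A)) nA => p; exists p@_0%MM.
  apply/mpolyP => k; rewrite mcoeffC (_ : k = 0%MM) ?eqxx ?mulr1 //.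
  by apply/mnmP => -[].
(* The extra variable goes to the last one, and the old variables keep their indices. *)
pose phi : {rmorphism {poly {mpoly A[m]}} -> {mpoly A[m.+1]}} :=
  [the {rmorphism _ -> _} of horner_eval 'X_ord_max \o map_poly (@mwiden m A)].
apply: (@noetherian_surj _ _ phi) (noetherian_poly IH) => p.
have phiC c : phi (c%:MP)%:P = c%:MP.
  by rewrite /phi /= /horner_eval map_polyC hornerC /= mwidenC.
have phiX i : exists x, phi x = 'X_i.
  case: (unliftP ord_max i) => [j ->|->]; last first.
    by exists 'X; rewrite /phi /= /horner_eval map_polyX hornerX.
  exists ('X_j)%:P; rewrite /phi /= /horner_eval map_polyC hornerC /= mwidenX.
  congr mpolyX; rewrite mnmwiden1; congr (U_(_))%MM; apply: val_inj => /=.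
  by rewrite /bump leqNgt ltn_ord.
elim/mpoly_ring_ind: p => [c|i|p q [x <-] [y <-]|p q [x <-] [y <-]].
- by exists (c%:MP)%:P.
- exact: phiX.
- by exists (x + y); rewrite rmorphD.
- by exists (x * y); rewrite rmorphM.
Qed.

(** * Graded-injective modules *)

Section Projection.

Variables (T : eqType) (V : zmodType) (C : T -> V -> Prop).
Hypothesis dC : direct_sum C.

Lemma big_uniq_extend (r t : seq T) (c : T -> V) : uniq r -> uniq t ->
  {subset r <= t} -> \sum_(j <- r) c j = \sum_(j <- t) (if j \in r then c j else 0).
Proof.
move=> ur ut rt; rewrite -big_mkcond -[RHS]big_filter; apply/perm_big/uniq_perm => //.
  exact: filter_uniq.
by move=> j; rewrite mem_filter; case: (boolP (j \in r)) => [/rt->|].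
Qed.

Lemma direct_sum_ex x : exists rc : seq T * (T -> V),
  [/\ uniq rc.1, forall j, C j (rc.2 j) & x = \sum_(j <- rc.1) rc.2 j].
Proof. by have [_ _ /(_ x)[r [c h]] _] := dC; exists (r, c). Qed.

Definition gproj (j : T) (x : V) : V :=
  let rc := projT1 (cid (direct_sum_ex x)) in if j \in rc.1 then rc.2 j else 0.

Lemma gprojE r c j : uniq r -> (forall j, C j (c j)) ->
  gproj j (\sum_(i <- r) c i) = if j \in r then c j else 0.
Proof.
have [C0 CB _ Cun] := dC; move=> ur hc; rewrite /gproj.
case: cid => -[r' c'] /= [ur' hc' e].
pose t := undup (j :: r ++ r').
have rt : {subset r <= t}.
  by move=> i ir; rewrite mem_undup in_cons mem_cat ir orbT.
have rt' : {subset r' <= t}.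
  by move=> i ir; rewrite mem_undup in_cons mem_cat ir !orbT.
have ut : uniq t by exact: undup_uniq.
have := Cun t (fun i => (if i \in r' then c' i else 0) - (if i \in r then c i else 0)).
move=> /(_ ut) H; apply/eqP; rewrite -subr_eq0; apply/eqP; apply: H.
- by move=> i; apply: CB; case: ifP.
- by rewrite sumrB -!big_uniq_extend // e subrr.
- by rewrite mem_undup mem_head.
Qed.

Lemma gproj_homog i j x : C i x -> gproj j x = if j == i then x else 0.
Proof.
have [C0 _ _ _] := dC; move=> hx.
have := @gprojE [:: i] (fun k => if k == i then x else 0) j isT.
rewrite big_seq1 eqxx inE => -> //; first by case: eqP.
by move=> k; case: eqP => [->|].
Qed.

Lemma gproj_comp j x : C j (gproj j x).
Proof.
have [C0 _ _ _] := dC; have [[r c] /= [ur hc ->]] := direct_sum_ex x.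
by rewrite gprojE //; case: ifP.
Qed.

Lemma gproj_is_additive j : zmod_morphism (gproj j).
Proof.
have [C0 CB _ _] := dC => x y.
have [[r c] /= [ur hc ->]] := direct_sum_ex x.
have [[r' c'] /= [ur' hc' ->]] := direct_sum_ex y.
rewrite !gprojE //; pose t := undup (r ++ r').
have ut : uniq t by exact: undup_uniq.
have rt : {subset r <= t} by move=> i ir; rewrite mem_undup mem_cat ir.
have rt' : {subset r' <= t} by move=> i ir; rewrite mem_undup mem_cat ir orbT.
rewrite (big_uniq_extend _ ur ut rt) (big_uniq_extend _ ur' ut rt') -sumrB.
rewrite gprojE //; last by move=> i; apply: CB; case: ifP.
case: ifP => // /negbT; rewrite mem_undup mem_cat negb_or => /andP[].
by move=> /negbTE-> /negbTE->; rewrite subr0.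
Qed.

HB.instance Definition _ j :=
  GRing.isZmodMorphism.Build V V (gproj j) (gproj_is_additive j).

Lemma gproj_sum x : exists2 r, uniq r & x = \sum_(j <- r) gproj j x.
Proof.
have [[r c] /= [ur hc e]] := direct_sum_ex x; exists r => //.
rewrite {1}e big_seq [RHS]big_seq; apply: eq_bigr => j jr.
by rewrite e gprojE // jr.
Qed.

End Projection.

(** [sigma] allows for maps that shift the degree, such as multiplication by a homogeneous
    element. *)
Lemma gproj_morph (T T' : eqType) (V V' : zmodType) (C : T -> V -> Prop)
    (C' : T' -> V' -> Prop) (dC : direct_sum C) (dC' : direct_sum C')
    (sigma : T -> T') (phi : {additive V -> V'}) :
  injective sigma -> (forall j x, C j x -> C' (sigma j) (phi x)) ->
  forall j x, gproj dC' (sigma j) (phi x) = phi (gproj dC j x).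
Proof.
move=> inj_sigma hphi j x; have [r ur ->] := gproj_sum dC x.
rewrite !raddf_sum; apply: eq_bigr => i _ /=.
have hi := gproj_comp dC i x.
rewrite (gproj_homog dC' _ (hphi _ _ hi)) (gproj_homog dC _ hi).
by rewrite (inj_eq inj_sigma); case: eqP => // _; rewrite raddf0.
Qed.

(** * Homogeneous cyclic submodules, twists and divisibility *)

Section Cyclic.

Variables (S : gring) (E : gmod S) (y0 : E) (n0 : int).
Hypothesis hy0 : gm_comp n0 y0.

Definition cyclic : pred E := fun y => `[< exists s, y = s *: y0 >].

Lemma cyclicP y : reflect (exists s, y = s *: y0) (y \in cyclic).
Proof. exact: asboolP. Qed.

Lemma cyclic_submod : submod_closed cyclic.
Proof.
split; first by apply/cyclicP; exists 0; rewrite scale0r.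
move=> a x y /cyclicP[s ->] /cyclicP[t ->]; apply/cyclicP; exists (a * s + t).
by rewrite scalerDl scalerA.
Qed.

HB.instance Definition _ := GRing.isSubmodClosed.Build S E cyclic cyclic_submod.

Record cyclic_mod := CyclicMod { cyclic_val :> E; _ : cyclic_val \in cyclic }.

HB.instance Definition _ := [isSub for cyclic_val].
HB.instance Definition _ := [Choice of cyclic_mod by <:].
HB.instance Definition _ := [SubChoice_isSubLmodule of cyclic_mod by <:].

Definition cyclic_comp (n : int) (y : cyclic_mod) : Prop := gm_comp n (val y).

Lemma cyclic_gproj (n : int) (y : E) : y \in cyclic -> gproj (gm_dec E) n y \in cyclic.
Proof.
move=> /cyclicP[s ->]; have [r _ ->] := gproj_sum (gr_dec S) s.
rewrite scaler_suml raddf_sum; apply: rpred_sum => d _.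
have hd := gm_scale (gproj_comp (gr_dec S) d s) hy0.
rewrite /= (gproj_homog _ n hd); case: eqP => _; last exact: rpred0.
by apply/cyclicP; exists (gproj (gr_dec S) d s).
Qed.

Lemma cyclic_dec : direct_sum cyclic_comp.
Proof.
have [C0 CB _ Cun] := gm_dec E; split.
- by move=> n; exact: C0.
- by move=> n x y hx hy; rewrite /cyclic_comp raddfB; exact: CB.
- move=> x; have [r ur e] := gproj_sum (gm_dec E) (val x).
  exists r, (fun n => CyclicMod (cyclic_gproj n (valP x))); split=> //.
    by move=> n; exact: gproj_comp.
  by apply: val_inj; rewrite raddf_sum /= {1}e.
- move=> r c ur hc hs j jr; apply: val_inj.
  apply: (Cun r (fun n => val (c n)) ur hc) => //.
  by rewrite -(raddf_sum val) hs raddf0.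
Qed.

Lemma cyclic_scale (d : nat) (n : int) (s : S) (x : cyclic_mod) :
  gr_comp d s -> cyclic_comp n x -> cyclic_comp (d%:Z + n) (s *: x).
Proof. by move=> hs hx; rewrite /cyclic_comp linearZ; exact: gm_scale. Qed.

Definition cyclic_gmod : gmod S := GMod cyclic_dec cyclic_scale.

End Cyclic.

Section Shift.

Variables (S : gring) (E : gmod S) (e : int).

(** The twist E(e) makes multiplication by an element of degree e a map of degree 0, as graded
    injectivity demands. *)
Definition shift_comp (n : int) (x : E) : Prop := gm_comp (n + e) x.

Lemma shift_dec : direct_sum shift_comp.
Proof.
have [C0 CB _ Cun] := gm_dec E; split.
- by move=> n; exact: C0.
- by move=> n x y; exact: CB.
- move=> x; have [r ur ex] := gproj_sum (gm_dec E) x.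
  exists [seq n - e | n <- r], (fun n => gproj (gm_dec E) (n + e) x); split.
  + by rewrite map_inj_uniq //; exact: addIr.
  + by move=> n; exact: gproj_comp.
  + by rewrite big_map {1}ex; apply: eq_bigr => n _; rewrite subrK.
- move=> r c ur hc hs j jr.
  have := Cun [seq n + e | n <- r] (fun n => c (n - e)).
  rewrite big_map map_inj_uniq; last exact: addIr.
  move=> /(_ ur) H; have := H _ _ (j + e); rewrite addrK; apply.
  + by move=> n; have := hc (n - e); rewrite /shift_comp subrK.
  + by rewrite -[RHS]hs; apply: eq_bigr => n _; rewrite addrK.
  + by apply/mapP; exists j.
Qed.

Lemma shift_scale (d : nat) (n : int) (s : S) (x : E) :
  gr_comp d s -> shift_comp n x -> shift_comp (d%:Z + n) (s *: x).
Proof. by move=> hs hx; rewrite /shift_comp -addrA; exact: gm_scale. Qed.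

Definition shift_gmod : gmod S := GMod shift_dec shift_scale.

End Shift.

Section CyclicMul.

Variables (S : gring) (E : gmod S) (y0 : E) (f : S).

Definition cyclic_mul (y : cyclic_mod y0) : E := f *: val y.

Lemma cyclic_mul_is_linear : linear cyclic_mul.
Proof.
move=> a x y; by rewrite /cyclic_mul raddfD linearZ /= !scalerA [f * a]mulrC.
Qed.

HB.instance Definition _ :=
  GRing.isLinear.Build S (cyclic_mod y0) E *:%R cyclic_mul cyclic_mul_is_linear.

Definition cyclic_incl (y : cyclic_mod y0) : E := val y.

Lemma cyclic_incl_is_linear : linear cyclic_incl.
Proof. by move=> a x y; rewrite /cyclic_incl linearP. Qed.

HB.instance Definition _ :=
  GRing.isLinear.Build S (cyclic_mod y0) E *:%R cyclic_incl cyclic_incl_is_linear.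

End CyclicMul.

(** The annihilators of the f^k x increase with k; their union is a finitely generated ideal, hence
    attained at a finite stage. *)
Lemma annihilator_stable (S : comNzRingType) (E : lmodType S) (f : S) (x : E) :
  noetherian S ->
  exists N, forall s k, (s * f ^+ k) *: x = 0 -> (s * f ^+ N) *: x = 0.
Proof.
move=> /noetherianP nS.
have mono s k j : (k <= j)%N -> (s * f ^+ k) *: x = 0 -> (s * f ^+ j) *: x = 0.
  by move=> /subnKC<- h; rewrite exprD mulrA mulrC -scalerA h scaler0.
have [|t [tJ Jt]] := nS (fun s => exists k, (s * f ^+ k) *: x = 0).
  split.
  - by exists 0%N; rewrite mul0r scale0r.
  - move=> s t [k hk] [j hj]; exists (maxn k j).
    rewrite mulrDl scalerDl (mono _ _ _ (leq_maxl _ _) hk).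
    by rewrite (mono _ _ _ (leq_maxr _ _) hj) addr0.
  - by move=> a s [k hk]; exists k; rewrite -mulrA -scalerA hk scaler0.
have [N hN] : exists N, {in t, forall s, (s * f ^+ N) *: x = 0}.
  elim: t tJ {Jt} => [|b t IH] tJ; first by exists 0%N.
  have [N hN] : exists N, {in t, forall s, (s * f ^+ N) *: x = 0}.
    by apply: IH => a ha; apply: tJ; rewrite in_cons ha orbT.
  have [k hk] := tJ b (mem_head _ _).
  exists (maxn k N) => a; rewrite in_cons => /orP[/eqP->|/hN].
    exact: mono (leq_maxl _ _) hk.
  exact: mono (leq_maxr _ _).
exists N => s k hs; have iN : is_ideal (fun s => (s * f ^+ N) *: x = 0).
  split; first by rewrite mul0r scale0r.
    by move=> a b ha hb; rewrite mulrDl scalerDl ha hb addr0.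
  by move=> a b hb; rewrite -mulrA -scalerA hb scaler0.
by apply: (span_ideal iN hN); apply: Jt; exists k.
Qed.

(* Extend the map f^(N+1) x |-> f^N x, which is well defined as soon as
   ann (f^N x) no longer grows with N. *)
Lemma graded_injective_div (S : gring) (E : gmod S) (e : nat) (f : S) (n : int)
    (x : E) : noetherian S -> graded_injective E ->
  gr_comp e f -> gm_comp (n + e%:Z) x ->
  exists u, [/\ gm_comp n u, exists N, f ^+ N *: (x - f *: u) = 0 &
    forall s, s *: x = 0 -> s *: u = 0].
Proof.
move=> nS injE hf hx; have [N hN] := annihilator_stable f x nS.
pose y0 := f ^+ N *: x; pose n0 := (e * N)%:Z + (n + e%:Z).
have hfk k : gr_comp (e * k) (f ^+ k).
  elim: k => [|k IH]; first by rewrite muln0; exact: gr_one.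
  by rewrite mulnS exprS; exact: gr_mul.
have hy0 : gm_comp n0 y0 by exact: gm_scale.
pose M := cyclic_gmod hy0; pose F := shift_gmod E e%:Z.
pose j : {linear M -> F} := @cyclic_mul S E y0 f.
pose i : {linear M -> E} := @cyclic_incl S E y0.
have [| | |h [hdeg hj]] := injE M F j i.
- by move=> k y hy; rewrite /= /shift_comp addrC; exact: gm_scale.
- by [].
- apply: raddf_inj => -[y hy] /= e0; apply: val_inj => /=.
  have /cyclicP[s es] := hy; move: e0; rewrite /j /= /cyclic_mul /= es.
  rewrite scalerA /y0 scalerA (_ : f * s * f ^+ N = s * f ^+ N.+1).
    by rewrite scalerA => /hN.
  by rewrite exprS; ring.
(* Put u = h x. As h (f y) = y on the cyclic module, f^N x = h (f^(N+1) x) = f^(N+1) u. Linearity of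
   [h] shows that whatever kills x kills u. *)
exists (h x); split; first exact: hdeg.
  exists N; have y0c : y0 \in cyclic y0.
    by apply/cyclicP; exists 1; rewrite scale1r.
  have := hj (CyclicMod y0c); rewrite /i /= /cyclic_incl /= => ey.
  have hZ s (z : E) : h (s *: z) = s *: h z by exact: linearZ_LR.
  move: ey; rewrite /j /= /cyclic_mul /= hZ {1}/y0 hZ => ey.
  by rewrite scalerBr -/y0 -{}ey !scalerA mulrC subrr.
by move=> s hs; rewrite -linearZ_LR /= hs raddf0.
Qed.

(** * The total complex of an injective resolution and torsion *)

Section HomogeneousElements.

Variable S : gring.

Record helt := HElt { he_deg : nat; he_val : S; he_comp : gr_comp he_deg he_val }.

HB.instance Definition _ := gen_eqMixin helt.

End HomogeneousElements.

Section TotalComplex.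

Variables (S : gring) (N : gmod S) (E : injres N).
Local Notation L := (helt S).

(** A product is used instead of a direct sum to avoid finite supports; this is harmless, as graded
    elements are concentrated in one degree. *)
Definition total : Type := forall q : nat, E q.

HB.instance Definition _ := gen_eqMixin total.
HB.instance Definition _ := gen_choiceMixin total.

Lemma totalP (x y : total) : (forall q, x q = y q) -> x = y.
Proof. exact: functional_extensionality_dep. Qed.

Definition total_zero : total := fun=> 0.
Definition total_opp (x : total) : total := fun q => - x q.
Definition total_add (x y : total) : total := fun q => x q + y q.

Lemma total_addA : associative total_add.
Proof. by move=> x y z; apply: totalP => q; exact: addrA. Qed.
Lemma total_addC : commutative total_add.
Proof. by move=> x y; apply: totalP => q; exact: addrC. Qed.
Lemma total_add0 : left_id total_zero total_add.
Proof. by move=> x; apply: totalP => q; exact: add0r. Qed.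
Lemma total_addN : left_inverse total_zero total_opp total_add.
Proof. by move=> x; apply: totalP => q; exact: addNr. Qed.

HB.instance Definition _ :=
  GRing.isZmodule.Build total total_addA total_addC total_add0 total_addN.

Lemma totalB (x y : total) q : (x - y) q = x q - y q.
Proof. by []. Qed.

Definition total_d (x : total) : total :=
  fun q => if q is k.+1 then ir_d E k (x k) else 0.

Lemma total_d_is_additive : zmod_morphism total_d.
Proof.
move=> x y; apply: totalP => -[|q]; rewrite totalB /=; first by rewrite subr0.
exact: raddfB.
Qed.

HB.instance Definition _ :=
  GRing.isZmodMorphism.Build total total total_d total_d_is_additive.

Definition total_f (l : L) (x : total) : total := fun q => he_val l *: x q.

Lemma total_f_is_additive l : zmod_morphism (total_f l).
Proof. by move=> x y; apply: totalP => q; rewrite totalB /total_f scalerBr. Qed.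

HB.instance Definition _ l :=
  GRing.isZmodMorphism.Build total total (total_f l) (total_f_is_additive l).

Lemma total_dd x : total_d (total_d x) = 0.
Proof.
apply: totalP => -[|[|q]] //=; first by rewrite raddf0.
by apply/ir_exactS; exists (x q).
Qed.

Lemma total_df l x : total_d (total_f l x) = total_f l (total_d x).
Proof.
by apply: totalP => -[|q]; rewrite /total_f /= ?scaler0 ?linearZ.
Qed.

Lemma total_ff l l' x : total_f l (total_f l' x) = total_f l' (total_f l x).
Proof. by apply: totalP => q; rewrite /total_f !scalerA mulrC. Qed.

Definition total_cx : complex L := Complex total_dd total_df total_ff.

Definition total_grading (q n : int) (x : total) : Prop :=
  forall k : nat, if k%:Z == q then gm_comp n (x k) else x k = 0.

Lemma total_bigraded : bigraded (@he_deg S) (total_grading : bigrading total_cx).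
Proof.
have C0 k n : @gm_comp S (E k) n 0 by have [h _ _ _] := gm_dec (E k).
split.
- by move=> q n k; case: eqP => _.
- move=> q n x y hx hy k; have := hy k; have := hx k; case: eqP => _.
    by have [_ CB _ _] := gm_dec (E k); exact: CB.
  by rewrite totalB => -> ->; rewrite subr0.
- move=> q n x hx [|k] /=; first by case: eqP.
  have -> : (k.+1%:Z == q + 1) = (k%:Z == q) by apply/eqP/eqP; lia.
  have := hx k.
  case: eqP => _ => [h|->]; last exact: raddf0.
  exact: ir_d_deg.
- move=> q n l x hx k; have := hx k; case: eqP => _ /= => [h|].
    by rewrite addrC; apply: gm_scale => //; exact: he_comp.
  by rewrite /total_f => ->; rewrite scaler0.
Qed.

Definition single (q : nat) (x : E q) : total :=
  fun k => if q =P k is ReflectT e then ecast i (E i) e x else 0.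

Lemma single_eq q (x : E q) : single x q = x.
Proof. by rewrite /single; case: eqP => // e; rewrite eq_axiomK. Qed.

Lemma single_ne q (x : E q) k : q != k -> single x k = 0.
Proof. by rewrite /single; case: eqP. Qed.

Lemma single_grading q n (x : E q) : gm_comp n x -> total_grading q%:Z n (single x).
Proof.
move=> hx k; rewrite eqz_nat eq_sym; case: eqP => [<-|/eqP ne].
  by rewrite single_eq.
by rewrite single_ne.
Qed.

Lemma single_is_additive q : zmod_morphism (@single q).
Proof.
move=> x y; apply: totalP => k; rewrite totalB.
have [<-|ne] := eqVneq q k; first by rewrite !single_eq.
by rewrite !single_ne // subr0.
Qed.

HB.instance Definition _ q :=
  GRing.isZmodMorphism.Build (E q) total (@single q) (@single_is_additive q).

Lemma single0 q : single (0 : E q) = 0.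
Proof.
apply: totalP => k; have [<-|ne] := eqVneq q k; first by rewrite single_eq.
by rewrite single_ne.
Qed.

Lemma total_single q n (x : total) : total_grading q%:Z n x -> x = single (x q).
Proof.
move=> hx; apply: totalP => k; have [<-|ne] := eqVneq q k; first by rewrite single_eq.
by have := hx k; rewrite eqz_nat eq_sym (negbTE ne) single_ne.
Qed.

Lemma total_d_single q (x : E q) : total_d (single x) = single (ir_d E q x).
Proof.
apply: totalP => -[|k] /=; first by rewrite single_ne.
have [<-|ne] := eqVneq q k; first by rewrite !single_eq.
by rewrite !single_ne ?raddf0 // eqSS.
Qed.

Lemma iter_total_f k l x q : iter k (total_f l) x q = he_val l ^+ k *: x q.
Proof.
elim: k => [|k IH]; first by rewrite expr0 scale1r.
by rewrite iterS /total_f IH scalerA exprS.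
Qed.

Lemma total_div q n l (x : total_cx) : noetherian S ->
  total_grading q (n + (he_deg l)%:Z) x ->
  exists u : total_cx, [/\ total_grading q n u, f_torsion l (x - cx_f total_cx l u) &
    forall l', f_torsion l' x -> f_torsion l' u].
Proof.
move=> nS; case: q => q hx; last first.
  have x0 : x = 0 by apply: totalP => k; have := hx k.
  exists 0; split.
  - by case: total_bigraded => h _ _ _; exact: h.
  - by exists 0%N; rewrite x0 raddf0 subrr.
  - by move=> l' _; exists 0%N.
have hxq : gm_comp (n + (he_deg l)%:Z) (x q) by have := hx q; rewrite eqxx.
have [u [hu [M hM] annu]] :=
  graded_injective_div nS (@ir_inj _ _ E q) (he_comp l) hxq.
exists (single u); split; first exact: single_grading.
  exists M; apply: totalP => k; rewrite iter_total_f.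
  rewrite totalB /= /total_f; have [<-|ne] := eqVneq q k; first by rewrite single_eq.
  by rewrite (total_single hx) !single_ne // scaler0 subrr scaler0.
move=> l' [k hk]; exists k; apply: totalP => j; rewrite iter_total_f.
have [<-|ne] := eqVneq q j; last by rewrite single_ne // scaler0.
rewrite single_eq; apply: annu.
by rewrite -iter_total_f [iter _ _ _]hk.
Qed.

End TotalComplex.

(** * Cech complexes and torsion *)

Section TorsionCech.

Variables (L : Type) (e : L -> nat) (C : complex L).

(** The cone along the first operator may be replaced by the [l]-torsion part of the bigrading. The
    third clause of the hypothesis keeps the quotient [u] torsion when [v] is, so divisibility
    survives this shrinking and the induction continues. *)
Lemma torsion_cech_acyclic ls (P : bigrading C) q n : bigraded e P ->
  (forall q n l v, P q (n + (e l)%:Z) v -> exists u,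
    [/\ P q n u, f_torsion l (v - cx_f C l u) &
        forall l', f_torsion l' v -> f_torsion l' u]) ->
  acyclic (fun q n v => P q n v /\ all_torsion ls v) q n <->
  acyclic (cech_grading e ls P) q n.
Proof.
elim: ls P => [|l ls IH] P gP divP /=.
  split=> acy v; first by move=> hv dv; have [|w [hw _] ->] := acy v _ dv; [|exists w].
  by move=> [hv _] dv; have [w hw ->] := acy v hv dv; exists w.
pose Q : bigrading C := fun q n v => P q n v /\ f_torsion l v.
have gQ : bigraded e Q by exact: f_torsion_bigraded.
have qPQ : qis Q (cone_grading e (l := l) P) (torsion_incl l (C := C)).
  apply: torsion_qis => // q' n' v /divP[u [hu tu _]]; by exists u.
rewrite -(cech_acyclic ls q n gQ (cone_bigraded l gP) qPQ) -IH //.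
  rewrite /Q; split=> acy v.
    by move=> [[hv tv] av] dv; have [|w [hw [tw aw]] ->] := acy v _ dv; [|exists w].
  by move=> [hv [tv av]] dv; have [|w [[hw tw] aw] ->] := acy v _ dv; [|exists w].
move=> q' n' l' v [hv tv]; have [u [hu tu annu]] := divP _ _ _ _ hv.
by exists u; split=> //; split=> //; exact: annu.
Qed.

End TorsionCech.

Section Torsion.

Variables (S : gring) (M : gmod S).

Lemma torsion_pow (I : S -> Prop) (x : M) f : I f -> torsion I x ->
  exists k, f ^+ k *: x = 0.
Proof.
move=> If [k hk]; exists k; have := hk (fun=> f) (fun=> If).
by rewrite prodr_const card_ord.
Qed.

(* Each factor of a long product is split as c b + a' with a' in (s), so that
   every term of the expansion has many factors b or many factors in (s). *)
Lemma span_torsion (s : seq S) (x : M) :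
  {in s, forall f, exists k, f ^+ k *: x = 0} ->
  exists k, forall t : seq S, (k <= size t)%N ->
    (forall a, a \in t -> span s a) -> (\prod_(a <- t) a) *: x = 0.
Proof.
elim: s => [|b s IH] hs.
  exists 1%N => -[|a t] //= _ ht; rewrite big_cons.
  by have /= -> := ht a (mem_head _ _); rewrite mul0r scale0r.
have [|k hk] := IH; first by move=> a ha; apply: hs; rewrite in_cons ha orbT.
have [N hN] := hs b (mem_head _ _).
exists (N + k)%N.
have H t : forall i t', (N + k <= i + size t' + size t)%N ->
    (forall a, a \in t' -> span s a) -> (forall a, a \in t -> span (b :: s) a) ->
    (b ^+ i * \prod_(a <- t') a * \prod_(a <- t) a) *: x = 0.
  elim: t => [|a t IHt] i t' hsz ht' ht.
    rewrite big_nil mulr1; case: (leqP N i) => [/subnKC <-|hi].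
      by rewrite exprD -mulrA mulrC -scalerA hN scaler0.
    rewrite -scalerA hk ?scaler0 //.
    by move: hsz hi => /=; lia.
  have [c hc] := ht a (mem_head _ _).
  have ht1 a' : a' \in t -> span (b :: s) a'.
    by move=> h; apply: ht; rewrite in_cons h orbT.
  have h1 : (b ^+ i * ((a - c * b) * \prod_(d <- t') d) * \prod_(d <- t) d) *: x = 0.
    have := IHt i ((a - c * b) :: t'); rewrite big_cons; apply=> //.
      by move: hsz => /=; lia.
    by move=> a'; rewrite in_cons => /orP[/eqP->|/ht'].
  have h2 : (b ^+ i.+1 * \prod_(d <- t') d * \prod_(d <- t) d) *: x = 0.
    by apply: IHt => //; move: hsz => /=; lia.
  rewrite big_cons (_ : b ^+ i * _ * _ =
    b ^+ i * ((a - c * b) * \prod_(d <- t') d) * \prod_(d <- t) d +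
    c * (b ^+ i.+1 * \prod_(d <- t') d * \prod_(d <- t) d)).
    by rewrite scalerDl h1 -scalerA h2 scaler0 addr0.
  by rewrite exprS; ring.
move=> t hsz ht; have := H t 0%N [::].
by rewrite big_nil expr0 !mul1r; apply.
Qed.

Lemma torsion_span (I : S -> Prop) (s : seq S) (x : M) :
  (forall a, I a -> span s a) ->
  {in s, forall f, exists k, f ^+ k *: x = 0} -> torsion I x.
Proof.
move=> Is /span_torsion[k hk]; exists k => a ha.
have := hk [seq a j | j : 'I_k]; rewrite size_map -cardE card_ord leqnn.
rewrite big_image /=; apply=> // b /imageP[j _ ->]; exact/Is/ha.
Qed.

End Torsion.

(** * Linear actions on polynomials *)

Section LinearAction.

Variables (A : comNzRingType) (m : nat).
Implicit Types (P Q : 'M[A]_m) (p : {mpoly A[m]}).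

Lemma lin_act_is_additive P : zmod_morphism (lin_act P).
Proof. by move=> p q; rewrite /lin_act raddfB. Qed.

Lemma lin_act_is_multiplicative P : monoid_morphism (lin_act P).
Proof.
by split=> [|p q]; rewrite /lin_act ?rmorph1 ?rmorphM.
Qed.

HB.instance Definition _ P :=
  GRing.isZmodMorphism.Build _ _ (lin_act P) (lin_act_is_additive P).
HB.instance Definition _ P :=
  GRing.isMonoidMorphism.Build _ _ (lin_act P) (lin_act_is_multiplicative P).

Lemma lin_actC P c : lin_act P c%:MP = c%:MP.
Proof. exact: comp_mpolyC. Qed.

Lemma lin_actZ P c p : lin_act P (c *: p) = c *: lin_act P p.
Proof. exact: comp_mpolyZ. Qed.

Lemma lin_actX P i : lin_act P 'X_i = \sum_k P k i *: 'X_k.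
Proof. by rewrite /lin_act comp_mpolyXU -tnth_nth tnth_mktuple. Qed.

Lemma lin_act_mul P Q p : lin_act (P *m Q) p = lin_act P (lin_act Q p).
Proof.
elim/mpoly_ring_ind: p => [c|i|p q IHp IHq|p q IHp IHq].
- by rewrite !lin_actC.
- rewrite !lin_actX raddf_sum /=.
  under [RHS]eq_bigr do rewrite lin_actZ lin_actX scaler_sumr.
  rewrite exchange_big; apply: eq_bigr => k _ /=.
  rewrite mxE scaler_suml; apply: eq_bigr => j _.
  by rewrite scalerA mulrC.
- by rewrite !raddfD /= IHp IHq.
- by rewrite !rmorphM /= IHp IHq.
Qed.

Lemma lin_act1 p : lin_act 1%:M p = p.
Proof.
elim/mpoly_ring_ind: p => [c|i|p q IHp IHq|p q IHp IHq].
- exact: lin_actC.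
- rewrite lin_actX (bigD1 i) //= mxE eqxx scale1r big1 ?addr0 // => k /negbTE.
  by rewrite mxE => ->; rewrite scale0r.
- by rewrite raddfD /= IHp IHq.
- by rewrite rmorphM /= IHp IHq.
Qed.

Lemma mderiv_lin_act P l p :
  (lin_act P p)^`M(l) = \sum_k P l k *: lin_act P p^`M(k).
Proof.
elim/mpoly_ring_ind: p => [c|i|p q IHp IHq|p q IHp IHq].
- rewrite lin_actC mderivC big1 // => k _.
  by rewrite mderivC raddf0 scaler0.
- have dX j k : ('X_j : {mpoly A[m]})^`M(k) = (j == k)%:R.
    rewrite mderivX mnm1E; case: eqP => [->|_]; last by rewrite scale0r.
    rewrite scale1r (_ : U_(k) - U_(k) = 0)%MM ?mpolyX0 //.
    by apply/mnmP => a; rewrite mnmBE subnn mnm0E.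
  rewrite lin_actX raddf_sum (bigD1 l) //= mderivZ dX eqxx big1 => [|k nk].
    rewrite (bigD1 i) //= dX eqxx big1 => [|k nk]; first by rewrite rmorph_nat.
    by rewrite dX eq_sym (negbTE nk) raddf0 scaler0.
  by rewrite mderivZ dX (negbTE nk) scaler0.
- rewrite (raddfD (lin_act P)) mderivD IHp IHq -big_split; apply: eq_bigr => k _.
  by rewrite mderivD (raddfD (lin_act P)) scalerDr.
- rewrite rmorphM /= mderivM IHp IHq mulr_suml mulr_sumr -big_split.
  apply: eq_bigr => k _ /=; rewrite mderivM raddfD /= !rmorphM scalerDr.
  by rewrite -scalerAl -scalerAr.
Qed.

(** Integer degrees let a derivative always have degree n - 1, constants being sent to the zero
    component of degree -1. *)
Definition mhomog (n : int) p : Prop :=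
  if n is Posz d then p \is d.-homog else p = 0.

Lemma mhomog0 n : mhomog n 0.
Proof. by case: n => n //; exact: dhomog0. Qed.

Lemma mhomogB n p q : mhomog n p -> mhomog n q -> mhomog n (p - q).
Proof.
case: n => n /=; first by move=> hp hq; rewrite rpredB.
by move=> -> ->; rewrite subr0.
Qed.

Lemma mhomogD n p q : mhomog n p -> mhomog n q -> mhomog n (p + q).
Proof.
move=> hp hq; rewrite -[q]opprK; apply: mhomogB => //; rewrite -sub0r.
by apply: mhomogB => //; exact: mhomog0.
Qed.

Lemma mhomogM k n p q : mhomog k p -> mhomog n q -> mhomog (n + k) (p * q).
Proof.
case: k => k; last by move=> -> _; rewrite mul0r; exact: mhomog0.
case: n => n; last by move=> _ ->; rewrite mulr0; exact: mhomog0.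
by move=> hp hq; rewrite -PoszD addnC; exact: dhomogM.
Qed.

Lemma mhomogZ n c p : mhomog n p -> mhomog n (c *: p).
Proof. by case: n => n /= => [|->]; [exact: dhomogZ | rewrite scaler0]. Qed.

Lemma mhomog_lin_act n P p : mhomog n p -> mhomog n (lin_act P p).
Proof. by case: n => n /= => [|->]; [exact: lin_act_homog | rewrite raddf0]. Qed.

Lemma mhomog_sum (I : finType) n (F : I -> {mpoly A[m]}) :
  (forall i, mhomog n (F i)) -> mhomog n (\sum_i F i).
Proof.
by move=> h; elim/big_ind: _ => [|p q|//]; [exact: mhomog0 | exact: mhomogD].
Qed.

Lemma mhomog_mderiv n l p : mhomog n p -> mhomog (n - 1) p^`M(l).
Proof.
case: n => n; last by move=> ->; rewrite raddf0; exact: mhomog0.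
move=> /dhomogP hp.
have supp k : k \in msupp p^`M(l) -> n = (mdeg k).+1.
  rewrite mcoeff_msupp mcoeff_deriv => hk.
  have /hp <- : (k + U_(l))%MM \in msupp p.
    by rewrite mcoeff_msupp; apply: contraNneq hk => ->; rewrite mul0rn.
  by rewrite /= mdegD mdeg1 addn1.
case: n supp {hp} => [|n] supp.
  suff -> : p^`M(l) = 0 by exact: mhomog0.
  apply/mpolyP => k; rewrite mcoeff0; apply/eqP; rewrite mcoeff_eq0.
  by apply/negP => /supp.
rewrite (_ : n.+1%:Z - 1 = n) /=; last by lia.
by apply/dhomogP => k /supp[].
Qed.

End LinearAction.

(** * The Reynolds operator and the Cech complex of the polynomial ring *)

Section InvariantRing.

Variables (A : comNzRingType) (m : nat) (gT : finGroupType).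
Variables (Phi : gT -> 'M[A]_m) (PhiGL : is_GL_hom Phi).
Variables (K : fieldType) (charK : [pchar K] =i pred0) (iota : {rmorphism K -> A}).
Variable (i0 : 'I_m).

Local Notation B := {mpoly A[m]}.
Local Notation S := (inv_gring Phi).
Local Notation L := (helt S).

Definition inv_nat (n : nat) : B := (iota (n%:R^-1))%:MP.

Lemma inv_natK n : inv_nat n.+1 *+ n.+1 = 1.
Proof.
have -> : inv_nat n.+1 *+ n.+1 = (iota (n.+1%:R^-1 *+ n.+1))%:MP.
  by rewrite /inv_nat !raddfMn.
have /pcharf0P K0 := charK.
by rewrite -[_^-1 *+ _]mulr_natl divff ?rmorph1 // K0.
Qed.

Lemma mhomog_inv_nat n : mhomog 0 (inv_nat n).
Proof.
rewrite /inv_nat /= -[_%:MP]mulr1 mul_mpolyC; exact: dhomogZ (dhomog1 _ _).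
Qed.

Definition act g p := lin_act (Phi g) p.

Lemma Phi1 : Phi 1%g = 1%:M.
Proof.
have [hinv hM] := PhiGL; have [Q [e _]] := hinv 1%g.
by rewrite -[LHS]mulmx1 -e mulmxA -hM mulg1.
Qed.

Lemma actM g h p : act (g * h)%g p = act g (act h p).
Proof. by have [_ hM] := PhiGL; rewrite /act hM lin_act_mul. Qed.

Lemma act1 p : act 1%g p = p.
Proof. by rewrite /act Phi1 lin_act1. Qed.

HB.instance Definition _ g :=
  GRing.isZmodMorphism.Build B B (act g) (lin_act_is_additive (Phi g)).
HB.instance Definition _ g :=
  GRing.isMonoidMorphism.Build B B (act g) (lin_act_is_multiplicative (Phi g)).

(* The conjugate g \o d/dX_i0 \o g^-1, by the chain rule. *)
Definition der g p : B := \sum_l Phi g^-1%g i0 l *: p^`M(l).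

Lemma der_is_additive g : zmod_morphism (der g).
Proof.
move=> p q; rewrite /der -sumrB; apply: eq_bigr => l _.
by rewrite mderivB scalerBr.
Qed.

HB.instance Definition _ g :=
  GRing.isZmodMorphism.Build B B (der g) (der_is_additive g).

Lemma derM g p q : der g (p * q) = p * der g q + der g p * q.
Proof.
rewrite /der mulr_sumr mulr_suml -big_split; apply: eq_bigr => l _ /=.
by rewrite mderivM scalerDr scalerAl scalerAr addrC.
Qed.

Lemma derC g h p : der g (der h p) = der h (der g p).
Proof.
have E a b : der a (der b p) =
    \sum_l \sum_k (Phi a^-1%g i0 l * Phi b^-1%g i0 k) *: p^`M(k)^`M(l).
  apply: eq_bigr => l _; rewrite (raddf_sum (mderiv l)) scaler_sumr.
  apply: eq_bigr => k _ /=.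
  by rewrite mderivZ scalerA.
rewrite !E exchange_big; apply: eq_bigr => k _; apply: eq_bigr => l _ /=.
by rewrite mulrC mderiv_comm.
Qed.

(** By the chain rule, row [i0] of Phi((hg)^-1) gets multiplied by Phi(h), which gives row [i0] of
    Phi(g^-1). *)
Lemma act_der h g p : act h (der g p) = der (h * g)%g (act h p).
Proof.
rewrite /der /act raddf_sum /=.
under [RHS]eq_bigr do rewrite mderiv_lin_act scaler_sumr.
rewrite exchange_big; apply: eq_bigr => k _ /=; rewrite lin_actZ.
under [RHS]eq_bigr do rewrite scalerA.
rewrite -scaler_suml; congr (_ *: _).
have [_ hM] := PhiGL.
have -> : (g^-1 = (h * g)^-1 * h)%g by rewrite invMg mulgKV.
by rewrite hM mxE.
Qed.

Lemma der1_X : der 1%g 'X_i0 = 1.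
Proof.
rewrite /der invg1 Phi1 (bigD1 i0) //= mxE eqxx scale1r big1 => [|l /negbTE nl].
  rewrite addr0 mderivX mnm1E eqxx scale1r (_ : U_(i0) - U_(i0) = 0)%MM ?mpolyX0 //.
  by apply/mnmP => a; rewrite mnmBE subnn mnm0E.
by rewrite mxE eq_sym nl scale0r.
Qed.

Lemma mhomog_der n g p : mhomog n p -> mhomog (n - 1) (der g p).
Proof.
by move=> hp; apply: mhomog_sum => l; apply/mhomogZ/mhomog_mderiv.
Qed.

Lemma reynolds_subproof p :
  inv_nat #|gT| * (\sum_g act g p) \in invariant Phi.
Proof.
apply/invariantP => h; rewrite -/(act h _) rmorphM /= raddf_sum /=.
rewrite [act h (inv_nat _)]lin_actC; congr (_ * _).
rewrite [RHS](reindex_inj (mulgI h)).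
by apply: eq_bigr => g _; rewrite actM.
Qed.

Definition reynolds p : inv_ring Phi := InvRing (reynolds_subproof p).

Lemma reynolds_is_additive : zmod_morphism reynolds.
Proof.
move=> p q; apply: val_inj; rewrite raddfB /= -mulrBr -sumrB; congr (_ * _).
by apply: eq_bigr => g _; rewrite raddfB.
Qed.

HB.instance Definition _ :=
  GRing.isZmodMorphism.Build B (inv_ring Phi) reynolds reynolds_is_additive.

Lemma act_inv (s : inv_ring Phi) g : act g (val s) = val s.
Proof. by have /invariantP := valP s; apply. Qed.

Lemma reynoldsM (s : inv_ring Phi) p : reynolds (p * val s) = reynolds p * s.
Proof.
apply: val_inj; rewrite rmorphM /= -mulrA mulr_suml; congr (_ * _).
by apply: eq_bigr => g _; rewrite rmorphM /= act_inv.
Qed.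

Lemma card_gT : #|gT| = #|gT|.-1.+1.
Proof. by rewrite prednK //; apply/card_gt0P; exists 1%g. Qed.

Lemma val_reynolds p : (forall g, act g p = p) -> val (reynolds p) = p.
Proof.
move=> hp; rewrite /= (eq_bigr (fun=> p)) // sumr_const -mulr_natr mulrCA.
by rewrite mulr_natr card_gT inv_natK mulr1.
Qed.

Lemma reynolds1 : reynolds 1 = 1.
Proof. by apply: val_inj; rewrite val_reynolds // => g; exact: rmorph1. Qed.

Lemma noetherian_invariants : noetherian A -> noetherian S.
Proof.
move=> nA.
exact: (noetherian_retract (iota := [the {rmorphism inv_ring Phi -> B} of val])
  reynolds1 reynoldsM (noetherian_mpoly nA)).
Qed.

Definition mulB (p q : B) : B := p * q.

Lemma mulB_is_additive p : zmod_morphism (mulB p).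
Proof. by move=> q r; exact: mulrBr. Qed.

HB.instance Definition _ p :=
  GRing.isZmodMorphism.Build B B (mulB p) (mulB_is_additive p).

Definition helt_poly (l : L) : B := val (he_val l : inv_ring Phi).

Definition poly_d (_ : B) : B := 0.

Lemma poly_d_is_additive : zmod_morphism poly_d.
Proof. by move=> p q; rewrite /poly_d subr0. Qed.

HB.instance Definition _ := GRing.isZmodMorphism.Build B B poly_d poly_d_is_additive.

Lemma poly_dd v : poly_d (poly_d v) = 0. Proof. by []. Qed.

Lemma poly_df l v : poly_d (mulB (helt_poly l) v) = mulB (helt_poly l) (poly_d v).
Proof. by rewrite /mulB mulr0. Qed.

Lemma poly_ff l l' v : mulB (helt_poly l) (mulB (helt_poly l') v) =
  mulB (helt_poly l') (mulB (helt_poly l) v).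
Proof. exact: mulrCA. Qed.

Definition poly_cx : complex L := Complex poly_dd poly_df poly_ff.

Definition poly_grading : bigrading poly_cx :=
  fun q n p => if q == 0 then mhomog n p else p = 0.

(** This bigrading picks out S inside R. Iterating cones with it gives fractions with invariant
    numerators, that is, the Cech complex of S inside that of R. *)
Definition inv_grading : bigrading poly_cx :=
  fun q n p => poly_grading q n p /\ forall g, act g p = p.

Lemma mhomog_helt l : mhomog (he_deg l)%:Z (helt_poly l).
Proof. exact: (he_comp l). Qed.

Lemma act_helt g l : act g (helt_poly l) = helt_poly l.
Proof. exact: act_inv. Qed.

Lemma poly_bigraded : bigraded (@he_deg S) poly_grading.
Proof.
split; rewrite /poly_grading.
- by move=> q n; case: eqP => // _; exact: mhomog0.
- move=> q n v w; case: eqP => _; first exact: mhomogB.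
  by move=> -> ->; rewrite subr0.
- by move=> q n v _; case: eqP => // _; exact: mhomog0.
- move=> q n l v; case: eqP => _ /= => [hv|->]; last by rewrite /mulB mulr0.
  by apply: mhomogM => //; exact: mhomog_helt.
Qed.

Lemma inv_bigraded : bigraded (@he_deg S) inv_grading.
Proof.
split; rewrite /inv_grading.
- by move=> q n; split; [exact: (bg0 poly_bigraded) | move=> g; exact: raddf0].
- move=> q n v w [hv iv] [hw iw]; split; first exact: (bgB poly_bigraded).
  by move=> g; rewrite raddfB /= iv iw.
- move=> q n v [hv _]; split; first exact: (bg_d poly_bigraded hv).
  by move=> g; exact: raddf0.
- move=> q n l v [hv iv]; split; first exact: (bg_f poly_bigraded).
  by move=> g; rewrite /= /mulB rmorphM /= iv act_helt.
Qed.

Lemma poly_weyl : weyl act der (@mhomog A m) helt_poly (inv_nat #|gT|)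
  poly_grading inv_grading.
Proof.
apply: (@Weyl L B gT act der (@mhomog A m) helt_poly (inv_nat #|gT|) poly_cx
  poly_grading inv_grading (fun p => mulB p) (fun g => act g) (fun g => der g)).
all: rewrite /= /mulB //.
- by move=> p q v; rewrite mulrDl.
- by move=> p q v; rewrite mulrA.
- by move=> v; rewrite mul1r.
- exact: actM.
- by move=> g p v; exact: rmorphM.
- exact: act_der.
- by move=> g p v; exact: derM.
- exact: derC.
- by move=> p v; rewrite mulr0.
- by move=> g v; rewrite [RHS]raddf0.
- by move=> g v; rewrite [RHS]raddf0.
- move=> q n k p v hp; rewrite /poly_grading; case: eqP => _; first exact: mhomogM.
  by move=> ->; rewrite mulr0.
- move=> q n g p; rewrite /poly_grading; case: eqP => _; first exact: mhomog_lin_act.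
  by move=> ->; exact: raddf0.
- move=> q n g p; rewrite /poly_grading; case: eqP => _; first exact: mhomog_der.
  by move=> ->; exact: raddf0.
- by move=> q n v [].
- by move=> q n g v [_].
- move=> q n v hv; split; last first.
    by move=> g; have /invariantP := reynolds_subproof v; apply.
  move: hv; rewrite /poly_grading; case: eqP => _ hv.
    rewrite -[n]addr0; apply: mhomogM; first exact: mhomog_inv_nat.
    by apply: mhomog_sum => g; exact: mhomog_lin_act.
  by rewrite hv big1 ?mulr0 // => g _; exact: raddf0.
Qed.

Lemma cech_inv_acyclic ls q (N : nat) :
  (forall n : int, (N%:Z < `|n|) ->
     acyclic (cech_grading (@he_deg S) ls inv_grading) q n) ->
  forall n, acyclic (cech_grading (@he_deg S) ls inv_grading) q n.
Proof.
have [W] := cech_weyl act_helt act_der derC mhomog_der mhomog_helt ls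
  poly_bigraded inv_bigraded poly_weyl.
apply: (weyl_acyclic (x0 := 'X_i0) _ _ _ _ _ _ _ _ W).
- by move=> n g p; exact: mhomog_lin_act.
- exact: actM.
- exact: act1.
- by rewrite card_gT inv_natK.
- by move=> c; exists (inv_nat c.+1); [exact: mhomog_inv_nat | exact: inv_natK].
- by rewrite /= dhomogX; apply/eqP; exact: mdeg1.
- exact: der1_X.
- exact: cech_bigraded poly_bigraded.
Qed.

End InvariantRing.

(** * Comparison of local and Cech cohomology *)

Section Generators.

Variables (S : gring) (I : S -> Prop).
Hypotheses (noethS : noetherian S) (idealI : is_ideal I) (homogI : homogeneous I).

Lemma homogeneous_generators : exists ls : seq (helt S),
  {in map (@he_val S) ls, forall f, I f} /\
  forall a, I a -> span (map (@he_val S) ls) a.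
Proof.
have /noetherianP := noethS; move=> /(_ _ idealI)[s [sI Is]].
suff [ls [lsI sls]] : exists ls : seq (helt S),
    {in map (@he_val S) ls, forall f, I f} /\
    {in s, forall a, span (map (@he_val S) ls) a}.
  by exists ls; split=> // a /Is; exact: span_trans.
elim: s sI {Is} => [|a s IH] sI; first by exists [::].
have [ls [lsI sls]] : exists ls : seq (helt S),
    {in map (@he_val S) ls, forall f, I f} /\
    {in s, forall a, span (map (@he_val S) ls) a}.
  by apply: IH => b hb; apply: sI; rewrite in_cons hb orbT.
have [r ur ea] := gproj_sum (gr_dec S) a.
pose la := [seq HElt (gproj_comp (gr_dec S) d a) | d <- r].
have ela : map (@he_val S) la = [seq gproj (gr_dec S) d a | d <- r].
  by rewrite -map_comp.
exists (la ++ ls); rewrite map_cat ela; split=> b; rewrite ?mem_cat.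
  case/orP=> [/mapP[d dr ->]|/lsI//].
  apply: (homogI ur (fun d => gproj_comp (gr_dec S) d a) _ dr).
  by rewrite -ea; apply: sI; rewrite mem_head.
rewrite in_cons => /orP[/eqP->|/sls h]; last exact: span_catr.
apply: span_catl; rewrite {2}ea big_seq.
elim/big_ind: _ => [|x y|d dr]; [exact: span0 | exact: spanD |].
by apply: span_mem; apply/mapP; exists d.
Qed.

Variables (N : gmod S) (E : injres N) (ls : seq (helt S)).
Hypothesis lsI : {in map (@he_val S) ls, forall f, I f}.
Hypothesis Ils : forall a, I a -> span (map (@he_val S) ls) a.

Lemma all_torsionP (v : total_cx E) : all_torsion ls v <->
  {in map (@he_val S) ls, forall f, exists k, forall q, f ^+ k *: v q = 0}.
Proof.
have torP l : f_torsion l v <-> exists k, forall q, he_val l ^+ k *: v q = 0.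
  split=> -[k hk]; exists k; last by apply: totalP => q; rewrite iter_total_f hk.
  by move=> q; rewrite -iter_total_f [iter _ _ _]hk.
elim: (ls) => [|l s IH] //=; split=> [[/torP hl /IH hs] f|h].
  by rewrite in_cons => /orP[/eqP->|/hs].
split; first by apply/torP/h; rewrite mem_head.
by apply/IH => f hf; apply: h; rewrite in_cons hf orbT.
Qed.

Lemma torsion_singleP q (x : E q) :
  torsion I x <-> all_torsion (C := total_cx E) ls (single x).
Proof.
rewrite all_torsionP; split=> [tx f /lsI/torsion_pow-/(_ _ _ tx)[k hk]|h].
  exists k => j; have [<-|ne] := eqVneq q j; first by rewrite single_eq.
  by rewrite single_ne // scaler0.
apply: torsion_span Ils _ => f /h[k hk]; exists k.
by have := hk q; rewrite single_eq.
Qed.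

(** A power of a homogeneous generator that kills [x] kills each component, since it sends distinct
    degrees to distinct degrees. *)
Lemma torsion_gproj q n (x : E q) :
  torsion I x -> torsion I (gproj (gm_dec (E q)) n x).
Proof.
move=> tx; apply: torsion_span Ils _ => f /mapP[l hl ->].
have [k hk] : exists k, he_val l ^+ k *: x = 0.
  by apply: torsion_pow tx; apply: lsI; apply/mapP; exists l.
exists k; have hlk : gr_comp (he_deg l * k) (he_val l ^+ k).
  elim: k {hk} => [|k IH]; first by rewrite muln0; exact: gr_one.
  by rewrite mulnS exprS; apply: gr_mul => //; exact: he_comp.
pose phi : {additive E q -> E q} := ( *:%R (he_val l ^+ k)).
have := @gproj_morph _ _ _ _ _ _ (gm_dec (E q)) (gm_dec (E q))
  (fun j => (he_deg l * k)%:Z + j) phi _ _ n x.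
rewrite /phi /= hk raddf0 => <- //; first exact: addrI.
by move=> j y hy; exact: gm_scale.
Qed.

(** It allows primitives of homogeneous elements to be chosen homogeneous. *)
Lemma ir_d_homog q n (y : E q) : gm_comp n (ir_d E q y) ->
  ir_d E q (gproj (gm_dec (E q)) n y) = ir_d E q y.
Proof.
move=> hx; have := @gproj_morph _ _ _ _ _ _ (gm_dec (E q)) (gm_dec (E q.+1))
  id (ir_d E q) _ _ n y.
rewrite (gproj_homog _ _ hx) eqxx => <- //.
exact: ir_d_deg.
Qed.

End Generators.

(** * From invariants to the injective resolution *)

Section Augmentation.

Variables (A : comNzRingType) (m : nat) (gT : finGroupType).
Variables (Phi : gT -> 'M[A]_m) (PhiGL : is_GL_hom Phi).
Variables (K : fieldType) (charK : [pchar K] =i pred0) (iota : {rmorphism K -> A}).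

Local Notation S := (inv_gring Phi).
Variable E : injres (reg_gmod S).

(** The source complex lives on R, so the augmentation of S is extended to R by the Reynolds
    operator; this is S-linear and the identity on invariants. *)
Definition augmentation (p : {mpoly A[m]}) : total_cx E :=
  single (ir_aug E (reynolds PhiGL iota p : S^o)).

Lemma augmentation_is_additive : zmod_morphism augmentation.
Proof. by move=> p q; rewrite /augmentation !raddfB. Qed.

HB.instance Definition _ :=
  GRing.isZmodMorphism.Build {mpoly A[m]} (total_cx E) augmentation
    augmentation_is_additive.

Lemma ir_aug_homog n (y : S) (x : E 0) : gm_comp n x -> ir_aug E (y : S^o) = x ->
  exists2 z : S, @reg_comp S n (z : S^o) & ir_aug E (z : S^o) = x.
Proof.
move=> hx ey; exists (gproj (reg_dec S) n (y : S^o)); first exact: gproj_comp.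
have := @gproj_morph _ _ _ _ _ _ (reg_dec S) (gm_dec (E 0)) id (ir_aug E) _ _ n y.
rewrite /= ey (gproj_homog _ _ hx) eqxx => <- //.
exact: (@ir_aug_deg S (reg_gmod S) E).
Qed.

Lemma total_grading0 q n : total_grading q n (0 : total_cx E).
Proof. exact: (bg0 (total_bigraded E)). Qed.

Lemma augmentation_qis :
  qis (inv_grading (Phi := Phi)) (total_grading (E := E) : bigrading (total_cx E))
    augmentation.
Proof.
have augE p : total_d (augmentation p) = 0.
  rewrite total_d_single (_ : ir_d E 0 _ = 0) ?raddf0 //.
  by apply/ir_exact0; eexists.
split.
- move=> l p; apply: totalP => k; rewrite /= /total_f /augmentation.
  have [<-|ne] := eqVneq 0%N k; last by rewrite !single_ne // scaler0.
  rewrite !single_eq /mulB mulrC reynoldsM mulrC.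
  exact: (@linearZ_LR _ _ _ _ (ir_aug E) (he_val l) (reynolds PhiGL iota p : S^o)).
- move=> q n p; rewrite /inv_grading /poly_grading.
  case: eqP => [->|_] [hp ip]; last by rewrite hp raddf0; exact: total_grading0.
  apply: single_grading; apply: ir_aug_deg.
  have vp : inv_val (reynolds PhiGL iota p) = p by exact: val_reynolds.
  case: n hp => n hp; first by rewrite /= /inv_comp vp.
  by apply: val_inj; rewrite /= in vp *; rewrite vp.
- by move=> q n p _; rewrite /= raddf0 augE.
- move=> q n p w [hp ip] _ hw ew; exists 0; first exact: (bg0 (inv_bigraded Phi)).
  rewrite /= /poly_d; move: hp; rewrite /poly_grading; case: eqP => // q0 _.
  have w0 : w = 0 by apply: totalP => k; have := hw k; rewrite q0.
  move: ew; rewrite w0 raddf0 /augmentation => ew.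
  have e0 : ir_aug E (reynolds PhiGL iota p : S^o) = 0 :=
    etrans (esym (single_eq _)) (congr1 (fun v : total E => v 0%N) ew).
  have e1 := ir_aug_inj (etrans e0 (esym (raddf0 (ir_aug E)))).
  by rewrite -(val_reynolds PhiGL charK iota ip) e1.
- move=> q n v hv dv.
  have dvk k : ir_d E k (v k) = 0 by have := congr1 (fun v : total E => v k.+1) dv.
  (* In degree 0 a cocycle comes from S, in positive degrees exactness makes it a boundary, and in
     negative degrees it is zero. *)
  have [q0|[k qk]|qN] : [\/ q = 0, exists k : nat, q = k.+1%:Z |
      forall k : nat, k%:Z <> q].
  + case: q {hv} => [[|k]|k]; [by constructor 1 | by constructor 2; exists k |].
    by constructor 3.
  + have hv0 : gm_comp n (v 0%N) by have := hv 0%N; rewrite q0.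
    have [y ey] := (ir_exact0 (v 0%N)).1 (dvk 0%N).
    have [z hz ez] := ir_aug_homog hv0 ey.
    have rz : reynolds PhiGL iota (inv_val z) = z.
      by apply: val_inj; apply: val_reynolds => // g; exact: act_inv.
    exists (inv_val z), 0; split => //.
    * split; last by move=> g; exact: act_inv.
      rewrite /poly_grading q0 eqxx; move: hz; case: (n) => j //=.
      by move=> ->.
    * exact: total_grading0.
    * rewrite raddf0 addr0 /= /augmentation rz ez.
      by apply: total_single; rewrite q0 in hv; exact: hv.
  + have hvk : gm_comp n (v k.+1) by have := hv k.+1; rewrite qk eqxx.
    have [y ey] := (ir_exactS (v k.+1)).1 (dvk k.+1).
    exists 0, (single (gproj (gm_dec (E k)) n y)); split=> //.
    * exact: (bg0 (inv_bigraded Phi)).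
    * rewrite qk (_ : k.+1%:Z - 1 = k%:Z); last by lia.
      by apply: single_grading; exact: gproj_comp.
    * rewrite raddf0 add0r /= total_d_single ir_d_homog ey //.
      by apply: total_single; rewrite qk in hv; exact: hv.
  + exists 0, 0; split=> //; first exact: (bg0 (inv_bigraded Phi)).
      exact: total_grading0.
    rewrite !raddf0 addr0; apply: totalP => k; have := hv k.
    by case: eqP => // /qN.
Qed.

End Augmentation.

(** * Local cohomology as cohomology of the torsion part *)

Section Coboundary.

Variables (S : gring) (I : S -> Prop) (N : gmod S) (E : injres N).
Variable ls : seq (helt S).
Hypothesis lsI : {in map (@he_val S) ls, forall f, I f}.
Hypothesis Ils : forall a, I a -> span (map (@he_val S) ls) a.

Definition torsion_grading : bigrading (total_cx E) :=
  fun q n v => total_grading q n v /\ all_torsion ls v.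

(** A torsion primitive may be replaced by its degree [n] component, which is still torsion. For i =
    0 the primitive has cohomological degree -1, hence is zero, which agrees with the separate
    clause of [coboundary]. *)
Lemma coboundaryP i n (x : E i) : gm_comp n x ->
  coboundary I x <->
  exists2 w, torsion_grading (i%:Z - 1) n w & single x = cx_d (total_cx E) w.
Proof.
have torE q (y : E q) := torsion_singleP lsI Ils y.
have single_inj j (y z : E j) : single y = single z -> y = z.
  by move=> e; rewrite -[y]single_eq e single_eq.
case: i x => [|i] x hx /=; last rewrite (_ : i.+1%:Z - 1 = i%:Z); last by lia.
  split=> [->|[w [hw _] ew]].
    exists 0; last by rewrite single0 raddf0.
    split; first exact: (bg0 (total_bigraded E)).
    by rewrite -(single0 E 0); apply/torE; exists 0%N => a _; rewrite scaler0.
  have w0 : w = 0 by apply: totalP => k; have := hw k.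
  by apply: single_inj; rewrite ew w0 raddf0 single0.
split=> [[y [ty ey]]|[w [hw tw] ew]].
  exists (single (gproj (gm_dec (E i)) n y)).
    split; first by apply: single_grading; exact: gproj_comp.
    by apply/torE; exact: (torsion_gproj lsI Ils).
  by rewrite /= total_d_single ir_d_homog ey.
exists (w i); split; first by apply/torE; rewrite -(total_single hw).
by apply: single_inj; rewrite ew [in RHS](total_single hw) /= total_d_single.
Qed.

Variables (M : gmod S) (i : nat) (pi : E i -> M).
Hypothesis pi_lin : forall (s : S) (x y : E i), cocycle I x -> cocycle I y ->
  pi (s *: x + y) = s *: pi x + pi y.
Hypothesis pi_deg : forall (n : int) (x : E i), cocycle I x -> gm_comp n x ->
  gm_comp n (pi x).
Hypothesis pi_surj : forall z : M, exists2 x : E i, cocycle I x & pi x = z.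
Hypothesis pi_ker : forall x : E i, cocycle I x -> (pi x = 0 <-> coboundary I x).

Lemma component0_acyclic n : (forall x : M, gm_comp n x -> x = 0) ->
  acyclic torsion_grading i%:Z n.
Proof.
move=> Mn0 v [hv tv] dv; have ev := total_single hv.
have hx : gm_comp n (v i) by have := hv i; rewrite eqxx.
have cx : cocycle I (v i).
  split; first by apply/(torsion_singleP lsI Ils); rewrite -ev.
  by have := congr1 (fun v : total E => v i.+1) dv.
rewrite [v]ev; apply/(coboundaryP hx)/(pi_ker cx)/Mn0; exact: pi_deg.
Qed.

Lemma acyclic_eq0 : (forall n, acyclic torsion_grading i%:Z n) ->
  forall x : M, x = 0.
Proof.
move=> acy z; have [x [tx dx] <-] := pi_surj z.
have cgproj n : cocycle I (gproj (gm_dec (E i)) n x).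
  split; first exact: (torsion_gproj lsI Ils).
  rewrite ir_d_homog ?dx //; last by have [h _ _ _] := gm_dec (E i.+1); exact: h.
have pi_gproj n : pi (gproj (gm_dec (E i)) n x) = 0.
  apply/(pi_ker (cgproj n))/(coboundaryP (gproj_comp (gm_dec (E i)) n x)).
  apply: acy; last by rewrite /= total_d_single (cgproj n).2 single0.
  split; first by apply: single_grading; exact: gproj_comp.
  by apply/(torsion_singleP lsI Ils); exact: (cgproj n).1.
have t0 j : torsion I (0 : E j) by exists 0%N => a _; rewrite scaler0.
have c0 : cocycle I (0 : E i) by split; [exact: t0 | rewrite raddf0].
have b0 j : coboundary I (0 : E j).
  by case: j => //= j; exists 0; split; [exact: t0 | rewrite raddf0].
have pi0 : pi 0 = 0 by apply/(pi_ker c0).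
(* [pi] is linear on cocycles only, so summing the homogeneous components of [x] requires every
   partial sum to be a cocycle. *)
have cD y y' : cocycle I y -> cocycle I y' -> cocycle I (y + y').
  move=> [ty dy] [ty' dy']; split; last by rewrite raddfD /= dy dy' addr0.
  apply: torsion_span Ils _ => f /lsI If.
  have [k hk] := torsion_pow If ty; have [k' hk'] := torsion_pow If ty'.
  exists (k + k')%N; rewrite scalerDr exprD -[in X in _ + X]scalerA hk'.
  by rewrite mulrC -scalerA hk !scaler0 addr0.
have [r _ ->] := gproj_sum (gm_dec (E i)) x.
suff [] : cocycle I (\sum_(n <- r) gproj (gm_dec (E i)) n x) /\
    pi (\sum_(n <- r) gproj (gm_dec (E i)) n x) = 0 by [].
elim: r => [|n r [cr pr]]; first by rewrite big_nil.
rewrite big_cons; split; first exact: cD.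
have := pi_lin 1 (cgproj n) cr; rewrite !scale1r => ->.
by rewrite pi_gproj pr addr0.
Qed.

End Coboundary.

Theorem theorem1p4
  (A : comNzRingType) (noethA : noetherian A)
  (K : fieldType) (charK : [pchar K] =i pred0) (iota : {rmorphism K -> A})
  (m : nat) (m_ge1 : (1 <= m)%N)
  (gT : finGroupType) (Phi : gT -> 'M[A]_m) (PhiGL : is_GL_hom Phi)
  (I : inv_gring Phi -> Prop) (idealI : is_ideal I) (homogI : homogeneous I)
  (i : nat) (M : gmod (inv_gring Phi))
  (MH : is_local_cohomology I i (reg_gmod (inv_gring Phi)) M) :
  (exists N : nat, forall n : int, (N%:Z < `|n|) ->
     forall x : M, gm_comp n x -> x = 0) ->
  forall x : M, x = 0.
Proof.
move=> [N bnd].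
have noethS := noetherian_invariants PhiGL charK iota noethA.
have [ls [lsI Ils]] := homogeneous_generators noethS idealI homogI.
have [E [pi [pi_lin pi_deg pi_surj pi_ker]]] := MH.
have gE := total_bigraded E; have gS := inv_bigraded Phi.
(* Both sides are compared with the Cech complex of the resolution: the augmentation links it to S,
   and divisibility of graded-injectives to the torsion part. *)
have equiv n : acyclic (torsion_grading (E := E) ls) i%:Z n <->
    acyclic (cech_grading (@he_deg _) ls (inv_grading (Phi := Phi))) i%:Z n.
  rewrite (cech_acyclic ls _ _ gS gE (augmentation_qis PhiGL charK iota E)).
  by apply: torsion_cech_acyclic => // q k l v; exact: total_div.
apply: (acyclic_eq0 lsI Ils pi_lin pi_surj pi_ker) => n; apply/equiv.
(* The assumption m >= 1 supplies the variable X_1. *)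
apply: (cech_inv_acyclic PhiGL charK iota (Ordinal m_ge1) (N := N)) => k hk.
by apply/equiv; apply: (component0_acyclic lsI Ils pi_deg pi_ker); exact: bnd.
Qed.
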